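(* Let $K$ be an algebraically closed field and let $\Lambda$ be a finite-dimensional indecomposable symmetric $K$-algebra with Jacobson radical $J$ satisfying $J^3=0$ and $J^2\ne0$. The minimal projective resolutions of the simple $\Lambda$-modules are periodic (a) of period $2n$ if $\Lambda$ is of type $A_n$; (b) of period $2n$ if $\Lambda$ is of type $L_n$; (c) of period $2n-3$ if $\Lambda$ is of type $D_n$ for $n$ even, and of period $2(2n-3)$ if $\Lambda$ is of type $D_n$ for $n$ odd; (d) of period $22$ if $\Lambda$ is of type $E_6$, of period $17$ if $\Lambda$ is of type $E_7$, and of period $29$ if $\Lambda$ is of type $E_8$.
   Context: Let $S_1,S_2,\dots$ be the simple $\Lambda$-modules up to isomorphism. $\Lambda$ is said to be of a given type if, for a suitable ordering of the simples, the matrix $(\dim_K \mathrm{Ext}^1_\Lambda(S_i,S_j))_{i,j}$ is the adjacency matrix of the diagram of that type (a loop at $i$ contributes $1$ to the $(i,i)$ entry). The diagrams: $A_n$ ($n\ge2$) is the path $1-2-\cdots-n$. $L_n$ ($n\ge2$) is the path $1-2-\cdots-n$ with one loop at vertex $1$. $D_n$ ($n\ge4$) has edges $1-3$, $2-3$, $3-4,\dots,(n-1)-n$. $E_6$ is the path $1-2-3-4-5$ with an edge $3-6$; $E_7$ is the path $1-2-\cdots-6$ with an edge $3-7$; $E_8$ is the path $1-2-\cdots-7$ with an edge $3-8$. ''Periodic of period $p$'', for a minimal projective resolution, is used without a further formal definition. A finite-dimensional algebra $\Lambda$ is symmetric if there is a linear map $\nu:\Lambda\to K$ with $\nu(ab)=\nu(ba)$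 for all $a,b$ whose kernel contains no nonzero left or right ideal. *)

(* Defs.v *)
From HB Require Import structures.
From mathcomp Require Import all_boot all_order all_algebra all_field.

Set Implicit Arguments.
Unset Strict Implicit.
Unset Printing Implicit Defensive.

Import GRing.Theory.
Local Open Scope ring_scope.

(* In a finite-dimensional algebra every one-sided ideal is a linear subspace,
   so ideals are represented by {vspace L}. *)
Section Algebras.

Variables (K : fieldType) (L : falgType K).

Definition left_ideal (I : {vspace L}) : Prop :=
  forall a x : L, x \in I -> a * x \in I.

Definition right_ideal (I : {vspace L}) : Prop :=
  forall a x : L, x \in I -> x * a \in I.

Definition two_sided_ideal (I : {vspace L}) : Prop :=
  left_ideal I /\ right_ideal I.

Definition maximal_left_ideal (I : {vspace L}) : Prop :=
  [/\ left_ideal I, I <> fullv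
    & forall I' : {vspace L},
        left_ideal I' -> (I <= I')%VS -> I' = I \/ I' = fullv].

Definition jacobson_radical (J : {vspace L}) : Prop :=
  forall x : L, x \in J <->
    (forall I : {vspace L}, maximal_left_ideal I -> x \in I).

Definition indecomposable_algebra : Prop :=
  forall I I' : {vspace L}, two_sided_ideal I -> two_sided_ideal I' ->
    (I + I')%VS = fullv -> (I :&: I')%VS = 0%VS ->
    I = 0%VS \/ I' = 0%VS.

Definition symmetric_algebra : Prop :=
  exists nu : {scalar L},
    (forall a b : L, nu (a * b) = nu (b * a)) /\
    (forall I : {vspace L}, left_ideal I \/ right_ideal I ->
       (forall x, x \in I -> nu x = 0) -> I = 0%VS).

End Algebras.

Section Modules.

Variable R : nzRingType.

Definition surjective_map (A B : Type) (f : A -> B) : Prop :=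
  forall y, exists x, f x = y.

Definition isomorphic_modules (M N : lmodType R) : Prop :=
  exists f : {linear M -> N}, bijective f.

Definition simple_module (M : lmodType R) : Prop :=
  (exists x : M, x <> 0) /\
  (forall U : {pred M}, submod_closed U ->
     (forall x, x \in U -> x = 0) \/ (forall x, x \in U)).

Definition projective_module (P : lmodType R) : Prop :=
  forall (M N : lmodType R) (g : {linear M -> N}) (f : {linear P -> N}),
    surjective_map g ->
    exists h : {linear P -> M}, forall x, g (h x) = f x.

Record projective_resolution (M : lmodType R) := ProjectiveResolution {
  res_term : nat -> lmodType R;
  res_diff : forall n, {linear res_term n.+1 -> res_term n};
  res_aug : {linear res_term 0 -> M};
  res_projective : forall n, projective_module (res_term n);
  res_aug_surj : surjective_map res_aug;
  res_exact0 : forall x : res_term 0,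
    res_aug x = 0 <-> exists y, res_diff 0 y = x;
  res_exactS : forall n (x : res_term n.+1),
    res_diff n x = 0 <-> exists y, res_diff n.+1 y = x
}.

(* The kernel of f is a superfluous submodule of M; a surjection from a
   projective module with this property is a projective cover. *)
Definition superfluous_kernel (M N : lmodType R) (f : {linear M -> N}) : Prop :=
  forall U : {pred M}, submod_closed U ->
    (forall x, exists u v, [/\ u \in U, f v = 0 & x = u + v]) ->
    forall x, x \in U.

Definition minimal_resolution (M : lmodType R) (P : projective_resolution M) :
    Prop :=
  superfluous_kernel (res_aug P) /\
  (forall n, superfluous_kernel (res_diff P n)).

(* An isomorphism of complexes from the resolution truncated at degree p onto
   the whole resolution. *)
Definition periodic_resolution (p : nat) (M : lmodType R)
    (P : projective_resolution M) : Prop :=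
  exists phi : forall n, {linear res_term P (n + p) -> res_term P n},
    (forall n, bijective (phi n)) /\
    (forall n (x : res_term P (n.+1 + p)),
       phi n (res_diff P (n + p) x) = res_diff P n (phi n.+1 x)).

Definition simples_have_period (p : nat) : Prop :=
  forall (S : lmodType R) (P : projective_resolution S),
    simple_module S -> minimal_resolution P -> periodic_resolution p P.

(* p is the least common period of the simple modules. An individual simple
   module may have a smaller period: in type A_3 the simple module at the middle
   vertex is isomorphic to its third syzygy. *)
Definition period_of_simples (p : nat) : Prop :=
  [/\ (0 < p)%N, simples_have_period p
    & forall q, (0 < q < p)%N -> ~ simples_have_period q].

Definition simples_enumeration (n : nat) (S : 'I_n -> lmodType R) : Prop :=
  [/\ forall i, simple_module (S i),
      forall i j, isomorphic_modules (S i) (S j) -> i = j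
    & forall M : lmodType R, simple_module M ->
        exists i, isomorphic_modules M (S i)].

End Modules.

Section ExtType.

Variables (K : fieldType) (L : falgType K).

(* dim_K Ext^1_L(M, N) = m, where Ext^1 is the first cohomology of
   Hom_L(P, N): there are m cocycles such that every cocycle is, modulo
   coboundaries, a unique K-linear combination of them. The scalar c : K acts on
   N as c%:A : L. The choice of P is immaterial. *)
Definition ext1_dim (M N : lmodType L) (m : nat) : Prop :=
  forall P : projective_resolution M,
  exists e : 'I_m -> {linear res_term P 1 -> N},
    (forall i x, e i (res_diff P 1 x) = 0) /\
    (forall f : {linear res_term P 1 -> N},
       (forall x, f (res_diff P 1 x) = 0) ->
       exists! c : 'rV[K]_m, exists g : {linear res_term P 0 -> N},
         forall x, f x - \sum_i (c 0 i)%:A *: e i x = g (res_diff P 0 x)).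

Definition of_type (n : nat) (A : 'M[nat]_n) : Prop :=
  exists S : 'I_n -> lmodType L,
    simples_enumeration S /\ forall i j, ext1_dim (S i) (S j) (A i j).

End ExtType.

(* The relations below are oriented edges on the vertices 1, 2, ..., n, while
   matrix indices start at 0. *)
Definition adjacency_matrix (n : nat) (e : rel nat) : 'M[nat]_n :=
  \matrix_(i < n, j < n) nat_of_bool (e i.+1 j.+1 || e j.+1 i.+1).

Definition diagram_A (n : nat) : 'M[nat]_n :=
  adjacency_matrix n (fun i j => j == i.+1).

Definition diagram_L (n : nat) : 'M[nat]_n :=
  adjacency_matrix n (fun i j => (j == i.+1) || (i == 1%N) && (j == 1%N)).

Definition diagram_D (n : nat) : 'M[nat]_n :=
  adjacency_matrix n
    (fun i j => (i == 1%N) && (j == 3) || (2 <= i)%N && (j == i.+1)).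

(* The path 1 - 2 - ... - (n - 1) with an edge 3 - n. *)
Definition diagram_E (n : nat) : 'M[nat]_n :=
  adjacency_matrix n
    (fun i j => (j < n)%N && (j == i.+1) || (i == 3) && (j == n)).

(* Main.v *)
Require Import Defs.
From HB Require Import structures.
From mathcomp Require Import all_boot all_order all_algebra all_field.
From mathcomp Require Import boolp zify.

Set Implicit Arguments.
Unset Strict Implicit.
Unset Printing Implicit Defensive.

Import GRing.Theory.
Local Open Scope ring_scope.

(* Every syzygy U of a simple module has Loewy length at most 2 and sits between
   J^2 Q and J Q for a projective module Q. Its stable endomorphism ring is K, so
   unless U = J^2 Q we get J U = J^2 Q. Reading off composition factors, the tops
   t_k of the syzygies satisfy t_{k+1} = A t_k - t_{k-1} for the adjacency matrix
   A, i.e. t_k = U_k(A) e_i with U_k the k-th Chebyshev polynomial of the second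
   kind, until U_h(A) e_i = 0. For a diagram with Coxeter number h + 1 (the
   diagram L_n being a quotient of A_{2n}), U_{h-1}(A) is the permutation matrix
   of a diagram involution tau, so the h-th syzygy of S_i is S_{tau i} and no
   earlier syzygy is simple. The period is h if tau is trivial and 2h if not. *)

(** * Minimal resolutions *)

(** The equality J U = J^2 Q carries the argument. If some z in J^2 Q lay outside J U, the
    symmetrizing form would produce an endomorphism of U that kills J U and fixes z. Stably it is a
    scalar c, and the error term maps Q into U, inside J Q, so it kills J^2 Q; vanishing on the
    nonzero J U then forces c = 0, although z is fixed. The stable endomorphism ring stays K from
    one syzygy to the next because free modules are injective, again thanks to the form. The diagram
    enters through dimensions only: e_j J e_i has dimension A_ij plus 1 if i = j. The extra 1 is J^2
    e_i, a copy of S_i because every vertex has a neighbour other than itself. Algebraic closedness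
    makes e L e equal to K modulo its radical for e primitive. Minimality of the period comes from
    the same equality: below degree h the module J U = J^2 Q is nonzero, so U is not semisimple. *)

Section LinearMaps.

Variables (R : nzRingType) (M N : lmodType R).

Definition linear_of (f : M -> N) (lf : linear f) : {linear M -> N} :=
  HB.pack f (GRing.isLinear.Build R M N *:%R f lf).

End LinearMaps.

Section Submodules.

Variables (R : nzRingType) (M : lmodType R).

(** Bundling the closure proof with the predicate gives the sub-lmodule instances below a key, while
    the definitions of the statement quantify over bare predicates. *)
Record subpred := Subpred {
  subpred_mem :> {pred M};
  subpred_closed : submod_closed subpred_mem }.

HB.instance Definition _ (U : subpred) :=
  GRing.isSubmodClosed.Build R M (subpred_mem U) (subpred_closed U).

Record submodule (U : subpred) := Submodule {
  submodule_val : M;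
  submodule_valP : submodule_val \in subpred_mem U }.

HB.instance Definition _ (U : subpred) := [isSub for @submodule_val U].
HB.instance Definition _ (U : subpred) := [Choice of submodule U by <:].
HB.instance Definition _ (U : subpred) :=
  [SubChoice_isSubLmodule of submodule U by <:].

End Submodules.

Section Resolutions.

Variable R : nzRingType.

Lemma image_closed (M N : lmodType R) (g : {linear M -> N}) :
  submod_closed [pred x | `[< exists y, g y = x >]].
Proof.
split; first by apply/asboolP; exists 0; rewrite linear0.
move=> a x y /asboolP[x' <-] /asboolP[y' <-].
by apply/asboolP; exists (a *: x' + y'); rewrite linearP.
Qed.

(** Projectivity is stated for surjections only, so both maps are corestricted to the image of
    [g]. *)
Lemma projective_lift (P M N : lmodType R) (g : {linear M -> N})
    (f : {linear P -> N}) : projective_module P ->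
  (forall x, exists y, g y = f x) ->
  exists h : {linear P -> M}, forall x, g (h x) = f x.
Proof.
move=> projP im_f; pose I := Subpred (image_closed g).
have gI x : g x \in subpred_mem I by apply/asboolP; exists x.
have fI x : f x \in subpred_mem I by apply/asboolP; apply: im_f.
have lg : linear (fun x => Submodule (gI x) : submodule I).
  by move=> a x y; apply: val_inj; rewrite /= linearP.
have lf : linear (fun x => Submodule (fI x) : submodule I).
  by move=> a x y; apply: val_inj; rewrite /= linearP.
have [|h hP] := projP _ _ (linear_of lg) (linear_of lf).
  case=> x xI; have /asboolP[y yx] := xI.
  by exists y; apply: val_inj.
by exists h => x; have /(congr1 (@submodule_val _ _ I)) := hP x.
Qed.

(* Uniqueness of projective covers, relative to the images of f and f'. *)
Lemma cover_iso (P P' M M' : lmodType R) (f : {linear P -> M})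
    (f' : {linear P' -> M'}) (phi : {linear M -> M'}) :
  projective_module P -> projective_module P' ->
  superfluous_kernel f -> superfluous_kernel f' -> injective phi ->
  (forall x, exists y, f' y = phi (f x)) ->
  (forall y, exists x, phi (f x) = f' y) ->
  exists h : {linear P -> P'}, bijective h /\ forall x, f' (h x) = phi (f x).
Proof.
move=> projP projP' supf supf' inj_phi im1 im2.
have lphif : linear (phi \o f) by move=> a x y; rewrite /= !linearP.
have [h hP] := projective_lift (f := linear_of lphif) projP im1.
have hsurj y : exists x, h x = y.
  apply/asboolP; apply: (supf' [pred x | `[< exists y, h y = x >]]).
    exact: image_closed.
  move=> x; have [z zx] := im2 x; exists (h z), (x - h z); split.
  - by apply/asboolP; exists z.
  - by rewrite linearB /= hP /= zx subrr.
  - by rewrite addrC subrK.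
have lid : linear (@idfun P') by [].
have [s sP] := projective_lift (g := h) (f := linear_of lid) projP' hsurj.
(* The same argument on the other side makes the section [s] surjective, hence a two-sided inverse
   of [h]. *)
have ssurj y : exists x, s x = y.
  apply/asboolP; apply: (supf [pred x | `[< exists y, s y = x >]]).
    exact: image_closed.
  move=> x; exists (s (h x)), (x - s (h x)); split.
  - by apply/asboolP; exists (h x).
  - apply: inj_phi; rewrite linear0 linearB linearB /=.
    by rewrite -[phi (f x)]hP -[phi (f (s _))]hP sP subrr.
  - by rewrite addrC subrK.
exists h; split => //; exists s => x; last exact: sP.
by have [y <-] := ssurj x; rewrite sP.
Qed.

(** * Uniqueness of minimal resolutions *)

Section Uniqueness.

Variables (M : lmodType R) (P P' : projective_resolution M).
Hypotheses (minP : minimal_resolution P) (minP' : minimal_resolution P').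

(** What the recursion has to carry: the next cover only sees the images of the two differentials.
    It is a sigma type so that [comparison] can be a [Fixpoint]. *)
Definition comparison_step n := {phi : {linear res_term P n -> res_term P' n} |
  bijective phi /\ forall x, (exists y, res_diff P n y = x) <->
    (exists y, res_diff P' n y = phi x)}.

Lemma comparison0 : {phi : {linear res_term P 0 -> res_term P' 0} |
  (bijective phi /\ (forall x, (exists y, res_diff P 0 y = x) <->
    (exists y, res_diff P' 0 y = phi x))) /\
  forall x, res_aug P' (phi x) = res_aug P x}.
Proof.
apply/cid; have lid : linear (@idfun M) by [].
have [] := @cover_iso _ _ _ _ (res_aug P) (res_aug P') (linear_of lid)
  (@res_projective _ _ P 0) (@res_projective _ _ P' 0) (proj1 minP) (proj1 minP').
- by move=> x y.
- by move=> x; apply: (res_aug_surj P').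
- by move=> x; apply: (res_aug_surj P).
move=> h [bh hP]; exists h; split => //; split=> // x.
by rewrite -!res_exact0 hP.
Qed.

Lemma comparisonS n (phi : comparison_step n) :
  {psi : {linear res_term P n.+1 -> res_term P' n.+1} |
  (bijective psi /\ (forall x, (exists y, res_diff P n.+1 y = x) <->
    (exists y, res_diff P' n.+1 y = psi x))) /\
  forall x, res_diff P' n (psi x) = sval phi (res_diff P n x)}.
Proof.
apply/cid; case: phi => phi [bphi phiP] /=.
have [] := @cover_iso _ _ _ _ (res_diff P n) (res_diff P' n) phi
  (@res_projective _ _ P n.+1) (@res_projective _ _ P' n.+1) (proj2 minP n)
  (proj2 minP' n) (bij_inj bphi).
- by move=> x; apply/phiP; exists x.
- move=> y; have [psi phiK psiK] := bphi.
  have [x xP] : exists x, res_diff P n x = psi (res_diff P' n y).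
    by apply/phiP; rewrite psiK; exists y.
  by exists x; rewrite xP psiK.
move=> h [bh hP]; exists h; split => //; split=> // x.
rewrite -!res_exactS hP; split=> [-> |]; first by rewrite linear0.
by rewrite -[RHS](linear0 phi) => /(bij_inj bphi).
Qed.

Fixpoint comparison n : comparison_step n :=
  match n with
  | 0 => exist _ (sval comparison0) (proj1 (svalP comparison0))
  | n.+1 => exist _ (sval (comparisonS (comparison n)))
              (proj1 (svalP (comparisonS (comparison n))))
  end.

Lemma minimal_resolution_iso :
  exists phi : forall n, {linear res_term P n -> res_term P' n},
    [/\ forall n, bijective (phi n),
        forall x, res_aug P' (phi 0%N x) = res_aug P x
      & forall n x, res_diff P' n (phi n.+1 x) = phi n (res_diff P n x)].
Proof.
exists (fun n => sval (comparison n)); split.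
- by move=> n; have [] := svalP (comparison n).
- by move=> x; have [_ ->] := svalP comparison0.
- by move=> n x; have [_ /= ->] := svalP (comparisonS (comparison n)).
Qed.

End Uniqueness.

(* T is isomorphic to the q-th syzygy of M: it is the cokernel of the
   differential ending in degree q. *)
Definition cokernel_at (M : lmodType R) (P : projective_resolution M) (q : nat)
    (T : lmodType R) : Prop :=
  exists g : {linear res_term P q -> T}, surjective_map g /\
    forall x, g x = 0 <-> exists y, res_diff P q y = x.

(** This is vacuous for a module without minimal resolution, so the lemmas that draw conclusions
    from it take one as an argument. *)
Definition syzygy (q : nat) (M T : lmodType R) : Prop :=
  forall P : projective_resolution M, minimal_resolution P -> cokernel_at P q T.

Lemma cokernel_at_iso (M : lmodType R) (P P' : projective_resolution M)
    (q : nat) (T : lmodType R) :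
  minimal_resolution P -> minimal_resolution P' ->
  cokernel_at P q T -> cokernel_at P' q T.
Proof.
move=> minP minP' [g [gsurj gP]].
have [phi [bphi _ phiP]] := minimal_resolution_iso minP' minP.
have lg : linear (g \o phi q) by move=> a x y; rewrite /= !linearP.
exists (linear_of lg); split.
  move=> t; have [x <-] := gsurj t; have [psi _ psiK] := bphi q.
  by exists (psi x); rewrite /= psiK.
move=> x /=; rewrite gP; split=> -[y yP].
  have [psi _ psiK] := bphi q.+1.
  exists (psi y); apply: (bij_inj (bphi q)).
  by rewrite -phiP psiK.
by exists (phi q.+1 y); rewrite phiP yP.
Qed.

Lemma syzygyP (q : nat) (M T : lmodType R) (P : projective_resolution M) :
  minimal_resolution P -> cokernel_at P q T -> syzygy q M T.
Proof. by move=> minP cP P' minP'; apply: cokernel_at_iso cP. Qed.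

Lemma sub_superfluous (M N N' : lmodType R) (f : {linear M -> N})
    (g : {linear M -> N'}) :
  superfluous_kernel f -> (forall x, g x = 0 -> f x = 0) -> superfluous_kernel g.
Proof.
move=> supf kergf U clU UP; apply: supf => // x.
by have [u [v [Uu gv ->]]] := UP x; exists u, v; split=> //; apply: kergf.
Qed.

Section Truncation.

Variables (M T : lmodType R) (P : projective_resolution M) (q : nat).
Variables (g : {linear res_term P q -> T}) (gsurj : surjective_map g).
Hypothesis gP : forall x, g x = 0 <-> exists y, res_diff P q y = x.

Definition truncation : projective_resolution T :=
  @ProjectiveResolution R T (fun n => res_term P (n + q))
    (fun n => res_diff P (n + q)) g (fun n => @res_projective _ _ P (n + q))
    gsurj gP (fun n => @res_exactS R M P (n + q)).

Lemma truncation_minimal : minimal_resolution P -> minimal_resolution truncation.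
Proof.
case=> supa supd; split=> [|n]; last exact: supd.
rewrite /=; case: q g gP => [|p] g' gP'.
  by apply: (sub_superfluous supa) => x /gP'/res_exact0.
by apply: (sub_superfluous (supd p)) => x /gP'/res_exactS.
Qed.

End Truncation.

Lemma syzygy_add (p q : nat) (M T V : lmodType R) :
  syzygy q M T -> syzygy p T V -> syzygy (p + q) M V.
Proof.
move=> sMT sTV P minP; have [g [gsurj gP]] := sMT P minP.
exact: (sTV (truncation gsurj gP) (truncation_minimal gsurj gP minP)).
Qed.

Lemma syzygy_sub (p q : nat) (M T V : lmodType R) (P : projective_resolution M) :
  minimal_resolution P ->
  syzygy q M T -> syzygy (p + q) M V -> syzygy p T V.
Proof.
move=> minP sMT sMV; have [g [gsurj gP]] := sMT P minP.
apply: (syzygyP (truncation_minimal gsurj gP minP)).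
exact: (sMV P minP).
Qed.

(** The truncation of [P] in degree [p] is again a minimal resolution of [M], so uniqueness compares
    it with [P] itself. *)
Lemma syzygy_periodic (p : nat) (M : lmodType R) (P : projective_resolution M) :
  minimal_resolution P -> syzygy p M M -> periodic_resolution p P.
Proof.
move=> minP sMM; have [g [gsurj gP]] := sMM P minP.
have [phi [bphi _ phiP]] :=
  minimal_resolution_iso (truncation_minimal gsurj gP minP) minP.
by exists phi; split=> // n x; rewrite phiP.
Qed.

Lemma periodic_syzygy (p : nat) (M : lmodType R) (P : projective_resolution M) :
  minimal_resolution P -> periodic_resolution p P -> syzygy p M M.
Proof.
move=> minP [phi [bphi phiP]]; apply: (syzygyP minP).
have lg : linear (res_aug P \o phi 0%N) by move=> a x y; rewrite /= !linearP.
exists (linear_of lg); split=> [t|x].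
  have [x <-] := res_aug_surj P t; have [psi _ psiK] := bphi 0%N.
  by exists (psi x); rewrite /= psiK.
rewrite /= res_exact0; split=> -[y yP].
  have [psi _ psiK] := bphi 1%N.
  exists (psi y); apply: (bij_inj (bphi 0%N)).
  by rewrite (phiP 0%N) psiK.
by exists (phi 1%N y); rewrite -(phiP 0%N) yP.
Qed.

Section Retarget.

Variables (M N : lmodType R) (f : {linear M -> N}) (bf : bijective f).
Variable P : projective_resolution M.

Lemma retarget_linear : linear (f \o res_aug P).
Proof. by move=> a x y; rewrite /= !linearP. Qed.

Lemma retarget_surj : surjective_map (linear_of retarget_linear).
Proof.
move=> y; have [g _ gK] := bf; have [x xP] := res_aug_surj P (g y).
by exists x; rewrite /= xP.
Qed.

Lemma retarget_kernel x : linear_of retarget_linear x = 0 <-> res_aug P x = 0.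
Proof.
split=> /= [|->]; last by rewrite linear0.
by rewrite -[RHS](linear0 f) => /(bij_inj bf).
Qed.

Lemma retarget_exact0 x : linear_of retarget_linear x = 0 <->
  exists y, res_diff P 0 y = x.
Proof. by rewrite retarget_kernel res_exact0. Qed.

(** Passes from an arbitrary simple module to its representative in an enumeration. Periodicity does
    not see the augmentation, so it holds for [P] as soon as it holds for [retarget]. *)
Definition retarget : projective_resolution N :=
  @ProjectiveResolution R N (res_term P) (res_diff P) (linear_of retarget_linear)
    (@res_projective R M P) retarget_surj retarget_exact0 (@res_exactS R M P).

Lemma retarget_minimal : minimal_resolution P -> minimal_resolution retarget.
Proof.
case=> supa supd; split=> //=.
by apply: (sub_superfluous supa) => x /retarget_kernel.
Qed.

End Retarget.

Lemma factor_through (P T V : lmodType R) (g : {linear P -> T})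
    (h : {linear P -> V}) :
  surjective_map g -> (forall x, g x = 0 -> h x = 0) ->
  exists f : {linear T -> V}, forall x, f (g x) = h x.
Proof.
move=> gsurj ker_gh.
have [f fP] : exists f : T -> V, forall x, f (g x) = h x.
  have /choice[s sP] : forall t, exists x, g x = t by [].
  exists (fun t => h (s t)) => x; apply/eqP; rewrite -subr_eq0 -linearB.
  by apply/eqP/ker_gh; rewrite linearB /= sP subrr.
have lf : linear f.
  move=> a x y; have [x' <-] := gsurj x; have [y' <-] := gsurj y.
  by rewrite -linearP !fP linearP.
by exists (linear_of lf).
Qed.

Lemma same_kernel_iso (P T V : lmodType R) (g : {linear P -> T})
    (h : {linear P -> V}) :
  surjective_map g -> surjective_map h -> (forall x, g x = 0 <-> h x = 0) ->
  isomorphic_modules T V.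
Proof.
move=> gsurj hsurj kerP.
have [f fP] := factor_through gsurj (fun x => proj1 (kerP x)).
have [f' fP'] := factor_through hsurj (fun x => proj2 (kerP x)).
exists f, f' => [t|v]; first by have [x <-] := gsurj t; rewrite fP fP'.
by have [x <-] := hsurj v; rewrite fP' fP.
Qed.

Lemma syzygy_unique (p : nat) (M T V : lmodType R) (P : projective_resolution M) :
  minimal_resolution P -> syzygy p M T -> syzygy p M V -> isomorphic_modules T V.
Proof.
move=> minP /(_ _ minP)[g [gsurj gP]] /(_ _ minP)[h [hsurj hP]].
by apply: (same_kernel_iso gsurj hsurj) => x; rewrite gP hP.
Qed.

End Resolutions.

(** * Primitive idempotents *)

Section RadicalCubeZero.

Variables (K : closedFieldType) (L : falgType K) (J : {vspace L}).
Hypotheses (radJ : jacobson_radical J) (J3 : (J ^+ 3)%VS = 0%VS).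

Lemma nilpotent_sub1 (y : L) (m : nat) : y ^+ m = 0 ->
  exists2 b, b * (1 - y) = 1 & (1 - y) * b = 1.
Proof.
move=> ym0; exists (\sum_(i < m) y ^+ i).
  rewrite -[RHS]subr0 -[X in _ = 1 - X]ym0; elim: m {ym0} => [|k IHk].
    by rewrite big_ord0 mul0r expr0 subrr.
  by rewrite big_ord_recr /= mulrDl IHk mulrBr mulr1 -exprSr addrA subrK.
rewrite -[RHS]subr0 -[X in _ = 1 - X]ym0; elim: m {ym0} => [|k IHk].
  by rewrite big_ord0 mulr0 expr0 subrr.
by rewrite big_ord_recr /= mulrDr IHk mulrBl mul1r -exprS addrA subrK.
Qed.

Lemma radical_left : left_ideal J.
Proof.
move=> a x /radJ xJ; apply/radJ => I maxI.
by have [leftI _ _] := maxI; apply: leftI; apply: xJ.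
Qed.

(** If a maximal left ideal I misses x, then I + L x contains 1, so I contains some 1 - w x. That
    element is invertible because w x is nilpotent. *)
Lemma mem_radical (x : L) :
  (forall a, exists m, (a * x) ^+ m = 0) -> x \in J.
Proof.
move=> nilx; apply/radJ => I maxI; case: (boolP (x \in I)) => // xnI.
have [leftI nfull maxP] := maxI.
have leftI' : left_ideal (I + limg (amulr x))%VS.
  move=> a y /memv_addP[u uI [v /memv_imgP[w _ ->] ->]]; rewrite mulrDr.
  apply: memv_add; first exact: leftI.
  apply/memv_imgP; exists (a * w); first exact: memvf.
  by rewrite !lfunE /= mulrA.
have [] := maxP _ leftI' (addvSl _ _).
- move=> eqI; case/negP: xnI; rewrite -eqI.
  apply: (subvP (addvSr I (limg (amulr x)))).
  by apply/memv_imgP; exists 1; [exact: memvf|rewrite lfunE /= mul1r].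
- move=> full; case: nfull; apply/vspaceP => y; rewrite memvf.
  have : 1 \in (I + limg (amulr x))%VS by rewrite full memvf.
  case/memv_addP=> u uI [v /memv_imgP[w _ ->]]; rewrite lfunE /= => oneE.
  have [m wx0] := nilx w; have [b b1 _] := nilpotent_sub1 wx0.
  by rewrite -[y]mulr1 -b1 mulrA leftI // oneE addrK.
Qed.

Lemma radical3 (a b c : L) : a \in J -> b \in J -> c \in J -> a * b * c = 0.
Proof.
move=> aJ bJ cJ; apply/eqP; rewrite -memv0 -J3.
by rewrite 2!expvSl expv1 prodvA !memv_mul.
Qed.

(** The radical is defined by left ideals, so this side needs an argument: a power of b x a can be
    regrouped to begin with the three elements b x, a b x, a b x of J. *)
Lemma radical_right : right_ideal J.
Proof.
move=> a x xJ; apply: mem_radical => b; exists 4; rewrite !exprS expr0 mulr1.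
have -> : b * (x * a) * (b * (x * a) * (b * (x * a) * (b * (x * a)))) =
    (b * x) * (a * b * x) * (a * b * x) * (a * b * x * a) by rewrite !mulrA.
by rewrite [X in X * _]radical3 ?mul0r //; apply: radical_left.
Qed.

Lemma annihilating_poly (x : L) :
  exists2 p : {poly K}, p != 0 & horner_alg x p = 0.
Proof.
pose n := \dim {:L}; pose X := [tuple x ^+ i | i < n.+1].
apply: contrapT => noP; have : free X.
  apply/freeP => k sum0 i; pose p := \poly_(i < n.+1) k (inord i).
  have p0 : p = 0.
    apply: contrapT => /eqP p0; apply: noP; exists p => //.
    rewrite /p poly_def linear_sum /= -[RHS]sum0; apply: eq_bigr => j _.
    rewrite linearZ rmorphXn /= horner_algX inord_val.
    by rewrite (nth_map ord0) ?size_enum_ord // nth_ord_enum mulr_algl.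
  have := congr1 (fun q : {poly K} => q`_i) p0.
  by rewrite coef_poly ltn_ord coef0 inord_val.
rewrite /free => /eqP; rewrite size_tuple => dimX.
by have := dimvS (subvf <<X>>); rewrite dimX ltnn.
Qed.

Definition primitive (e : L) : Prop := [/\ e != 0, e * e = e
  & forall f, f * f = f -> e * f = f -> f * e = f -> f = 0 \/ f = e].

(* Fitting's lemma: the polynomial annihilating y splits off an idempotent of
   eLe, which is trivial because e is primitive and not e because y v = 0. *)
Lemma primitive_nilpotent (e y v : L) : primitive e -> e * y = y -> y * e = y ->
  v != 0 -> e * v = v -> y * v = 0 -> exists m, y ^+ m = 0.
Proof.
case=> _ _ prim ey ye v0 ev yv.
have [p p0 py] := annihilating_poly y.
have [m [q]] := multiplicity_XsubC p 0; rewrite p0 /= subr0 -coprimepX => cqX pE.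
(* The exponent [m.+1] instead of [m] puts at least one factor [y] into the idempotent [f] below, so
   that [f] lies in eLe even when [m = 0]. *)
have [u [w uwE]] : exists u w : {poly K}, u * q + w * 'X^(m.+1) = 1.
  have /Bezout_coprimepP[[u w] /eqpP[[c1 c2] /andP[_ c20] /= E]] :=
    coprimep_expr m.+1 cqX.
  exists ((c2^-1 * c1) *: u), ((c2^-1 * c1) *: w).
  by rewrite -!scalerAl -scalerDr -scalerA E scalerA mulVf // scale1r.
have qX0 : horner_alg y (q * 'X^(m.+1)) = 0.
  by rewrite exprSr mulrA -pE rmorphM /= py mul0r.
have hE (r : {poly K}) : horner_alg y (r * 'X^(m.+1)) = horner_alg y (r * 'X^m) * y.
  by rewrite exprSr mulrA rmorphM /= horner_algX.
have hE' (r : {poly K}) : horner_alg y (r * 'X^(m.+1)) = y * horner_alg y (r * 'X^m).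
  by rewrite exprS mulrCA rmorphM /= horner_algX.
pose f := horner_alg y (w * 'X^(m.+1)).
have f1 : horner_alg y (u * q) = 1 - f.
  by rewrite -(rmorph1 (horner_alg y)) -uwE rmorphD /= addrK.
have ff : f * f = f.
  apply/eqP; rewrite eq_sym -subr_eq0 -{1}[f]mulr1 -mulrBr -f1 -rmorphM.
  by rewrite mulrACA [_ * q]mulrC rmorphM /= qX0 mulr0.
have [||f0|fe] := prim f ff.
- by rewrite /f hE' mulrA ey.
- by rewrite /f hE -mulrA ye.
- exists m.+1; rewrite -[LHS]mulr1 -[1](subr0) -f0 -f1 -[y in y ^+ _](horner_algX y).
  by rewrite -rmorphXn -rmorphM mulrCA ['X^_ * q]mulrC rmorphM /= qX0 mulr0.
- by case/eqP: v0; rewrite -ev -fe /f hE -mulrA yv mulr0.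
Qed.

(** An annihilating polynomial of x splits into linear factors. Applying them to e one after the
    other, the vector becomes zero at some factor X - c; then x - c e kills a nonzero vector of e L
    and is nilpotent by Fitting. *)
Lemma primitive_scalar (e x : L) : primitive e -> e * x = x -> x * e = x ->
  exists c, exists m, (x - c *: e) ^+ m = 0.
Proof.
move=> prim ex xe; have [e0 ee _] := prim.
have [p p0 px] := annihilating_poly x.
have [rs pE] := closed_field_poly_normal p.
have : horner_alg x (\prod_(z <- rs) ('X - z%:P)) * e = 0.
  move: px; rewrite pE linearZ /= mulr_algl => /eqP; rewrite scaler_eq0 lead_coef_eq0.
  by rewrite (negPf p0) /= => /eqP->; rewrite mul0r.
suff main v : v != 0 -> e * v = v ->
    horner_alg x (\prod_(z <- rs) ('X - z%:P)) * v = 0 ->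
    exists c, exists m, (x - c *: e) ^+ m = 0 by apply: main.
elim: rs {pE} v => [|c rs IH] v v0 ev.
  by rewrite big_nil rmorph1 mul1r => /eqP; rewrite (negPf v0).
rewrite big_cons mulrC rmorphM -mulrA.
have -> : horner_alg x ('X - c%:P) * v = x * v - c *: v.
  by rewrite rmorphB /= horner_algX horner_algC mulrBl -scalerAl mul1r.
have [xv _|xv] := eqVneq (x * v - c *: v) 0; last first.
  by apply: IH => //; rewrite mulrBr mulrA ex -scalerAr ev.
exists c; apply: (@primitive_nilpotent e _ v) => //.
- by rewrite mulrBr ex -scalerAr ee.
- by rewrite mulrBl xe -scalerAl ee.
- by rewrite mulrBl -scalerAl ev.
Qed.

(** For any a, the element z = y e a e is c e plus a nilpotent. If c = 0, then a y is nilpotent,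
    since its powers are a z^k y. If c is nonzero, z is invertible in e L e, so y has a right
    inverse there, which a nilpotent y cannot have. *)
Lemma primitive_nil_radical (e y : L) (m : nat) : primitive e -> e * y = y ->
  y * e = y -> y ^+ m = 0 -> y \in J.
Proof.
move=> prim ey ye ym; have [e0 ee _] := prim.
apply: mem_radical => a; pose z := y * (e * a * e).
have [||c [k zk]] := @primitive_scalar e z prim.
- by rewrite /z mulrA ey.
- by rewrite /z -!mulrA ee.
have [c0|c0] := eqVneq c 0.
  exists k.+1; suff -> : (a * y) ^+ k.+1 = a * z ^+ k * y.
    by move: zk; rewrite c0 scale0r subr0 => ->; rewrite mulr0 mul0r.
  elim: k {zk} => [|k IH]; first by rewrite expr1 expr0 mulr1.
  rewrite exprSr IH [z ^+ k.+1]exprSr /z -!mulrA; congr (_ * (_ * _)).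
  by rewrite [e * y]ey !mulrA ye.
have [|b _ b1] := @nilpotent_sub1 (- (c^-1 *: (z - c *: e))) k.
  by rewrite exprNn exprZn zk scaler0 mulr0.
have zb : z * b = c *: e.
  have zE : z = c *: (e * (1 - - (c^-1 *: (z - c *: e)))).
    have ez : e * z = z by rewrite /z mulrA ey.
    rewrite opprK mulrDr mulr1 -scalerAr mulrBr -scalerAr ee ez.
    by rewrite scalerDr scalerA divff // scale1r addrC subrK.
  by rewrite {1}zE -scalerAl -mulrA b1 mulr1.
have yw : y * (c^-1 *: (e * a * e * b)) = e.
  by rewrite -scalerAr mulrA -/z zb scalerA mulVf // scale1r.
suff ye0 k' : y ^+ k' * e = 0 -> e = 0.
  by case/eqP: e0; apply: (ye0 m); rewrite ym mul0r.
elim: k' => [|k' IH]; first by rewrite expr0 mul1r.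
move=> yk; have yk0 : y ^+ k'.+1 = 0 by rewrite -yk exprSr -mulrA ye.
by apply: IH; rewrite -yw mulrA -exprSr yk0 mul0r.
Qed.


(** The local ring e L e has residue field K. *)
Lemma primitive_local (e x : L) : primitive e ->
  exists c, e * x * e - c *: e \in J.
Proof.
move=> prim; have [_ ee _] := prim.
have [||c [m cm]] := @primitive_scalar e (e * x * e) prim.
- by rewrite !mulrA ee.
- by rewrite -!mulrA ee.
exists c; apply: (primitive_nil_radical prim) cm.
- by rewrite mulrBr !mulrA ee -scalerAr ee.
- by rewrite mulrBl -!mulrA ee -scalerAl ee.
Qed.

Lemma primitive_notin_radical (e : L) : primitive e -> e \notin J.
Proof.
case=> e0 ee _; apply/negP => eJ; case/eqP: e0.
by rewrite -ee -[e in e * _]ee radical3.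
Qed.

Section SimpleModules.

Variables (S : lmodType L) (simS : simple_module S).

(** The vectors killed by J form a submodule. If it were zero, a nonzero vector could be multiplied
    by elements of J three times without vanishing. *)
Lemma simple_radical (a : L) (s : S) : a \in J -> a *: s = 0.
Proof.
pose U : {pred S} := [pred x | `[< forall a, a \in J -> a *: x = 0 >]].
have clU : submod_closed U.
  split; first by apply/asboolP => b _; rewrite scaler0.
  move=> b x y /asboolP xU /asboolP yU; apply/asboolP => d dJ.
  rewrite scalerDr scalerA xU ?yU ?addr0 //; exact: radical_right.
have [[x x0] /(_ U clU)[U0|UT]] := simS; last first.
  by move=> aJ; have /asboolP := UT s; apply.
have notU (y : S) : y <> 0 -> exists2 b, b \in J & b *: y <> 0.
  move=> y0; apply: contrapT => nob; case: y0; apply: U0; apply/asboolP => b bJ.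
  by apply: contrapT => by0; apply: nob; exists b.
have [b bJ b0] := notU _ x0; have [d dJ d0] := notU _ b0.
have [f fJ] := notU _ d0.
by rewrite !scalerA radical3 // scale0r.
Qed.

Lemma simple_generator (s : S) : s <> 0 -> forall x, exists a : L, a *: s = x.
Proof.
move=> s0 x; pose U : {pred S} := [pred x | `[< exists a : L, a *: s = x >]].
have clU : submod_closed U.
  split; first by apply/asboolP; exists 0; rewrite scale0r.
  move=> b y z /asboolP[c <-] /asboolP[d <-]; apply/asboolP.
  by exists (b * c + d); rewrite scalerDl scalerA.
have [_ /(_ U clU)[U0|UT]] := simS; last by have /asboolP := UT x.
by case: s0; apply: U0; apply/asboolP; exists 1; rewrite scale1r.
Qed.

(** Descent on the dimension of L e from e = 1: a nonprimitive e splits as f + (e - f), and one of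
    the two summands does not kill s. *)
Lemma simple_primitive :
  exists2 e, primitive e & exists2 s : S, s <> 0 & e *: s = s.
Proof.
suff main m (e : L) (s : S) : (\dim (limg (amulr e)) < m)%N -> e * e = e ->
    s <> 0 -> e *: s = s ->
    exists2 e, primitive e & exists2 s : S, s <> 0 & e *: s = s.
  have [[s s0] _] := simS; apply: (main _ 1 s (ltnSn _)) => //.
  - by rewrite mulr1.
  - by rewrite scale1r.
elim: m e s => // m IH e s; rewrite ltnS => dime ee s0 es.
have [prim|nprim] := pselect (primitive e); first by exists e => //; exists s.
have [f [ff ef fe f0 fne]] :
    exists f, [/\ f * f = f, e * f = f, f * e = f, f <> 0 & f <> e].
  apply: contrapT => nof; case: nprim; split=> // [|f ff ef fe].
    by apply/eqP => e0; apply: s0; rewrite -es e0 scale0r.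
  by apply: contrapT => /not_orP[f0 fne]; apply: nof; exists f.
have smaller g : g * g = g -> e * g = g -> g * e = g -> g <> e ->
    (\dim (limg (amulr g)) < m)%N.
  move=> gg eg ge gne; apply: leq_trans dime.
  have sub : (limg (amulr g) <= limg (amulr e))%VS.
    apply/subvP => _ /memv_imgP[x _ ->]; rewrite lfunE /= -ge.
    by apply/memv_imgP; exists (x * g); [exact: memvf|rewrite lfunE /= mulrA].
  rewrite (ltn_leqif (dimv_leqif_sup sub)); apply/negP => /subvP/(_ e).
  case/(_ _)/memv_imgP.
    by rewrite -{1}ee; apply/memv_imgP; exists e; [exact: memvf|rewrite lfunE].
  by move=> x _; rewrite lfunE /= => eE; apply: gne; rewrite -eg {1}eE -mulrA gg -eE.
have [fs0|fs0] := pselect (f *: s = 0).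
  apply: (IH (e - f) s) => //.
  - apply: smaller.
    + by rewrite mulrBr !mulrBl ee ef fe ff subrr subr0.
    + by rewrite mulrBr ee ef.
    + by rewrite mulrBl ee fe.
    + by move/eqP; rewrite subr_eq addrC -subr_eq subrr eq_sym => /eqP.
  - by rewrite mulrBr !mulrBl ee ef fe ff subrr subr0.
  - by rewrite scalerBl es fs0 subr0.
apply: (IH f (f *: s)) => //; first exact: smaller.
by rewrite scalerA ff.
Qed.

End SimpleModules.

End RadicalCubeZero.

(** * One primitive idempotent for each simple module *)

Section Idempotents.

Variables (K : closedFieldType) (L : falgType K) (J : {vspace L}).
Hypotheses (radJ : jacobson_radical J) (J3 : (J ^+ 3)%VS = 0%VS).

(** This makes J e the largest proper submodule of L e. Some e a y is outside J, since otherwise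
    every b y would have its square in J and y would be in J. Modulo J this e a y is a nonzero
    multiple of e, hence e up to a left unit. *)
Lemma primitive_divides (e y : L) : primitive e -> y * e = y -> y \notin J ->
  exists a, a * y = e.
Proof.
move=> prim ye ynJ; have [_ ee _] := prim.
have [a eaynJ] : exists a, e * a * y \notin J.
  apply: contrapT => nea; case/negP: ynJ; apply: (mem_radical radJ) => b.
  have eaJ a : e * a * y \in J.
    by apply: contrapT => /negP ?; apply: nea; exists a.
  have b2 : (b * y) ^+ 2 \in J.
    have -> : (b * y) ^+ 2 = (b * y) * (e * b * y) by rewrite expr2 -{1}ye !mulrA.
    exact: (radical_left radJ).
  exists (2 * 3)%N; rewrite exprM; move: (_ ^+ 2) b2 => z zJ.
  by rewrite !exprS expr0 mulr1 mulrA (radical3 J3).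
have [c cJ] := primitive_local radJ (a * y) prim.
have {}cJ : e * a * y - c *: e \in J by move: cJ; rewrite !mulrA -(mulrA _ y) ye.
have c0 : c != 0 by apply: contraNneq eaynJ => c0; move: cJ; rewrite c0 scale0r subr0.
pose j := e * a * y - c *: e.
have [|b b1 _] := @nilpotent_sub1 _ _ (- (c^-1 *: j)) 3.
  rewrite !exprS expr0 mulr1 mulrA (radical3 J3) // rpredN rpredZ //.
exists (b * (c^-1 *: (e * a))).
have -> : b * (c^-1 *: (e * a)) * y = b * ((1 - - (c^-1 *: j)) * e).
  rewrite -mulrA; congr (_ * _); rewrite opprK mulrDl mul1r /j.
  rewrite -!scalerAl mulrBl -scalerAl ee -(mulrA _ y) ye scalerBr scalerA mulVf //.
  by rewrite scale1r addrC subrK.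
by rewrite mulrA b1 mul1r.
Qed.

Lemma simple_annihilator (S : lmodType L) (e : L) (s : S) : simple_module S ->
  primitive e -> s <> 0 -> e *: s = s ->
  forall x : L, x *: s = 0 <-> x * e \in J.
Proof.
move=> simS prim s0 es x; have [_ ee _] := prim; split=> [xs|xeJ]; last first.
  by rewrite -es scalerA (simple_radical radJ J3).
apply: contrapT => /negP xenJ.
have [|a axe] := primitive_divides prim _ xenJ; first by rewrite -mulrA ee.
by apply: s0; rewrite -es -axe -!scalerA es xs scaler0.
Qed.

Variables (n : nat) (S : 'I_n -> lmodType L).
Hypothesis enumS : simples_enumeration S.
Variables (e : 'I_n -> L) (s : forall i, S i).
Hypotheses (prim_e : forall i, primitive (e i)) (s0 : forall i, s i <> 0).
Hypothesis es : forall i, e i *: s i = s i.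

Lemma idem_e i : e i * e i = e i.
Proof. by have [] := prim_e i. Qed.

(** An element y of e_j L e_i outside J has a left inverse a' with a' y = e_i, and then y a' is a
    nonzero idempotent of e_j L e_j, hence e_j. The vector a' s_j of S_j is fixed by e_i, so it has
    the same annihilator as s_i, and S_i is isomorphic to S_j. *)
Lemma isotypic_radical i j x : i != j -> e j * x * e i \in J.
Proof.
move=> neq_ij; have [simS uniqS _] := enumS.
apply: contrapT => /negP ynJ; set y := e j * x * e i in ynJ.
have ye : y * e i = y by rewrite /y -!mulrA idem_e.
have ey : e j * y = y by rewrite /y !mulrA idem_e.
have [a ay] := primitive_divides (prim_e i) ye ynJ.
pose a' := e i * a * e j.
have a'y : a' * y = e i by rewrite /a' -mulrA ey -mulrA ay idem_e.
have ff : y * a' * (y * a') = y * a'.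
  by rewrite mulrA -(mulrA y) a'y ye.
have [_ _ prim] := prim_e j.
have [] := prim _ ff.
- by rewrite mulrA ey.
- by rewrite -mulrA; congr (_ * _); rewrite /a' -mulrA idem_e.
- move=> f0; have [/eqP[]] := prim_e i.
  by rewrite -(idem_e i) -{1}a'y -a'y mulrA -(mulrA a') f0 mulr0 mul0r.
move=> f1; pose t := a' *: s j.
have t0 : t <> 0.
  by move=> t0; apply: (s0 (i := j)); rewrite -es -f1 -scalerA -/t t0 scaler0.
have et : e i *: t = t by rewrite /t scalerA /a' !mulrA idem_e.
have lin (T : lmodType L) (z : T) : linear (fun b : L^o => (b : L) *: z).
  by move=> b c d; rewrite scalerDl scalerA.
case/eqP: neq_ij; apply: uniqS.
apply: (@same_kernel_iso _ L^o _ _ (linear_of (lin _ (s i)))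
  (linear_of (lin _ t))) => [u|u|u].
- by have [b <-] := simple_generator (simS i) (s0 (i := i)) u; exists b.
- by have [b <-] := simple_generator (simS j) t0 u; exists b.
- rewrite /= (simple_annihilator (simS i) (prim_e i) (s0 (i := i)) (es i)).
  by rewrite (simple_annihilator (simS j) (prim_e i) t0 et).
Qed.

Lemma simple_eigen i (x : S i) : e i *: x = x -> exists c : K, x = c%:A *: s i.
Proof.
move=> ex; have [simS _ _] := enumS.
have [a aE] := simple_generator (simS i) (s0 (i := i)) x.
have [c cJ] := primitive_local radJ a (prim_e i).
exists c; have := simple_radical radJ J3 (simS i) (s i) cJ.
rewrite scalerBl -!scalerA es aE ex => /eqP; rewrite subr_eq0 => /eqP->.
by rewrite -{1}[e i]mul1r scalerAl -scalerA es.
Qed.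

Lemma simple_orth i j (x : S j) : i != j -> e i *: x = 0.
Proof.
move=> neq_ij; have [simS _ _] := enumS.
have [a <-] := simple_generator (simS j) (s0 (i := j)) x.
rewrite -es !scalerA (simple_radical radJ J3) // isotypic_radical //.
by rewrite eq_sym.
Qed.

Variable nu : {scalar L}.
Hypothesis nu_nondeg : forall x, (forall a, nu (a * x) = 0) -> x = 0.

(* If W were proper, its annihilator with respect to the form nu would contain
   a simple left ideal killed by every e i. *)
Lemma idempotents_generate (W : {vspace L}) :
  (forall a i b, a * e i * b \in W) -> W = fullv.
Proof.
move=> WP; apply: contrapT => Wne.
have [x x0 Wx] : exists2 x, x != 0 & forall w, w \in W -> nu (w * x) = 0.
  pose f (x : L) : 'rV[K]_(\dim W) := \row_k nu ((vbasis W)`_k * x).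
  have lf : linear f.
    by move=> a y z; apply/rowP => k; rewrite !mxE mulrDr linearD -scalerAr linearZ.
  pose fl : 'Hom(L, 'rV[K]_(\dim W)) := linfun (linear_of lf).
  have ker0 : lker fl != 0%VS.
    apply/eqP => ker0; have := limg_ker_dim fl fullv.
    rewrite capfv ker0 dimv0 add0n => dimE; apply: Wne; apply/eqP.
    rewrite eqEdim subvf /= -dimE; apply: leq_trans (dimvS (subvf _)) _.
    by rewrite dimvf /dim /= mul1n.
  exists (vpick (lker fl)); first by rewrite vpick0.
  have := memv_pick (lker fl); rewrite memv_ker lfunE /= => /eqP/rowP ker w wW.
  rewrite (coord_vbasis wW) mulr_suml linear_sum /= big1 // => k _.
  by rewrite -scalerAl linearZ /=; have := ker k; rewrite !mxE => ->; rewrite mulr0.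
have Wx0 y a i b : y = a * e i * b * x -> y = 0.
  by move=> ->; apply: nu_nondeg => c; rewrite !mulrA Wx.
(* Descent on dimension inside L x to a minimal left ideal L y. *)
have [y [y0 Wy miny]] : exists y, [/\ y != 0, forall a i b, a * e i * b * y = 0 &
    forall z, z != 0 -> z \in limg (amulr y) -> y \in limg (amulr z)].
  have {}Wx a i b : a * e i * b * x = 0 by apply: Wx0.
  move: {2}(\dim _).+1 (ltnSn (\dim (limg (amulr x)))) => m.
  elim: m x x0 Wx {Wx0} => // m IH x x0 Wx; rewrite ltnS => dimx.
  have [|nomin] := pselect (forall z, z != 0 -> z \in limg (amulr x) ->
    x \in limg (amulr z)); first by exists x.
  have [z z0 [zx xz]] : exists2 z, z != 0 &
      z \in limg (amulr x) /\ x \notin limg (amulr z).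
    apply: contrapT => noz; apply: nomin => z z0 zx; apply: contrapT => /negP xz.
    by apply: noz; exists z.
  have /memv_imgP[w _ zE] := zx; rewrite lfunE /= in zE.
  apply: (IH z z0) => [a i b|]; first by rewrite zE mulrA -(mulrA _ b) Wx.
  have sub : (limg (amulr z) <= limg (amulr x))%VS.
    apply/subvP => _ /memv_imgP[v _ ->]; rewrite lfunE /= zE mulrA.
    by apply/memv_imgP; exists (v * w); [exact: memvf|rewrite lfunE].
  apply: leq_trans dimx; rewrite (ltn_leqif (dimv_leqif_sup sub)).
  apply: contra xz => /subvP; apply.
  by apply/memv_imgP; exists 1; [exact: memvf|rewrite lfunE /= mul1r].
have imgP z : (z \in limg (amulr y)) <-> exists a, z = a * y.
  split=> [/memv_imgP[a _ ->]|[a ->]]; first by exists a; rewrite lfunE.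
  by apply/memv_imgP; exists a; [exact: memvf|rewrite lfunE].
have clT : submod_closed (fun z : L^o => (z : L) \in limg (amulr y)).
  split; first exact: mem0v.
  move=> a u v /imgP[b ->] /imgP[c ->]; apply/imgP.
  by exists (a * b + c); rewrite mulrDl -mulrA.
pose T := submodule (Subpred clT).
have yT : y \in limg (amulr y) by apply/imgP; exists 1; rewrite mul1r.
have simT : simple_module T.
  split; first by exists (@Submodule _ _ (Subpred clT) y yT) => /(congr1 val)/eqP; apply/negP.
  move=> U [U0 clU]; have [|nz] := pselect (forall x, x \in U -> x = 0); first by left.
  right=> -[t tT]; have [[z zT] zU z0] : exists2 z, z \in U & z <> 0.
    by apply: contrapT => noz; apply: nz => z zU; apply: contrapT => z0; apply: noz; exists z.
  have {}z0 : z != 0 by apply/eqP => zE; apply: z0; apply: val_inj.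
  have /memv_imgP[a _ yE] := miny z z0 zT; rewrite lfunE /= in yE.
  have [b tE] := (imgP t).1 tT.
  have -> : Submodule tT = (b * a) *: Submodule zT + 0 :> T.
    by apply: val_inj; rewrite addr0 /= tE yE mulrA.
  exact: clU.
(* The simple module L y is some S_i, where e_i fixes the nonzero vector s_i, yet e_i kills L y. *)
have [_ _ /(_ _ simT)[i [f bf]]] := enumS.
have [g fK gK] := bf.
have := s0 (i := i); apply; rewrite -(gK (s i)).
have -> : g (s i) = 0; last by rewrite linear0.
apply: val_inj => /=; have eg : e i *: g (s i) = g (s i).
  by apply: (can_inj fK); rewrite linearZ /= gK es.
rewrite -eg /=; case: (g (s i)) => u uT /=; have [b ->] := (imgP u).1 uT.
by have := Wy 1 i b; rewrite mul1r -mulrA.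
Qed.

End Idempotents.

(** * Submodules of free modules *)

(* Finite-dimensional modules are realised as stable subspaces of free modules
   {ffun I -> L}, and their homomorphisms as right multiplication by matrices. *)
Section FreeModules.

Variables (K : fieldType) (L : falgType K).

Section OneModule.

Variable I : finType.
Implicit Types (a b : L) (x y : {ffun I -> L}).

(** The vector space structure over K stays the canonical one, as [{vspace _}] needs it, so the
    action of L is a separate function. *)
Definition lact a x : {ffun I -> L} := [ffun l => a * x l].

Lemma lact_linear a : linear (lact a).
Proof.
by move=> c x y; apply/ffunP => l; rewrite !ffunE mulrDr scalerAr.
Qed.
HB.instance Definition _ a :=
  GRing.isLinear.Build K {ffun I -> L} {ffun I -> L} *:%R (lact a) (lact_linear a).

Lemma lactl_linear x : linear (lact^~ x).
Proof.
by move=> c a b; apply/ffunP => l; rewrite !ffunE mulrDl scalerAl.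
Qed.
Definition lactl x : {linear L -> {ffun I -> L}} := linear_of (lactl_linear x).

Lemma lactA a b x : lact a (lact b x) = lact (a * b) x.
Proof. by apply/ffunP => l; rewrite !ffunE mulrA. Qed.
Lemma lact1 x : lact 1 x = x.
Proof. by apply/ffunP => l; rewrite !ffunE mul1r. Qed.
Lemma lactDl a b x : lact (a + b) x = lact a x + lact b x.
Proof. exact: (linearD (lactl x)). Qed.
Lemma lactBl a b x : lact (a - b) x = lact a x - lact b x.
Proof. exact: (linearB (lactl x)). Qed.
Lemma lactZl c a x : lact (c *: a) x = c *: lact a x.
Proof. exact: (linearZZ (lactl x)). Qed.
Lemma lact0l x : lact 0 x = 0.
Proof. exact: (linear0 (lactl x)). Qed.

Definition delta (l : I) a : {ffun I -> L} := [ffun m => if m == l then a else 0].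

Lemma delta_linear l : linear (delta l).
Proof.
move=> c a b; apply/ffunP => m; rewrite !ffunE.
by case: eqP; rewrite ?scaler0 ?addr0.
Qed.
HB.instance Definition _ l :=
  GRing.isLinear.Build K L {ffun I -> L} *:%R (delta l) (delta_linear l).

Lemma lact_delta a l b : lact a (delta l b) = delta l (a * b).
Proof. by apply/ffunP => m; rewrite !ffunE; case: eqP; rewrite ?mulr0. Qed.

Lemma sum_delta x : x = \sum_l delta l (x l).
Proof.
apply/ffunP => m; rewrite sum_ffunE (bigD1 m) //= ffunE eqxx big1 ?addr0 //.
by move=> l lm; rewrite ffunE eq_sym (negPf lm).
Qed.

Definition prodsp (W : I -> {vspace L}) : {vspace {ffun I -> L}} :=
  (\sum_l linfun (delta l) @: W l)%VS.

Lemma prodspP (W : I -> {vspace L}) x :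
  reflect (forall l, x l \in W l) (x \in prodsp W).
Proof.
apply: (iffP idP) => [/memv_sumP[v vW ->] m|xW].
  rewrite sum_ffunE; apply: rpred_sum => l _.
  have /memv_imgP[a aW ->] := vW l isT; rewrite lfunE ffunE.
  by case: eqP => [->|]; rewrite ?mem0v.
rewrite [x]sum_delta; apply: memv_sumr => l _.
by apply/memv_imgP; exists (x l); rewrite ?lfunE.
Qed.

Lemma dim_prodsp (W : I -> {vspace L}) :
  \dim (prodsp W) = (\sum_l \dim (W l))%N.
Proof.
have dir : directv (\sum_l linfun (delta l) @: W l)%VS.
  apply/directv_sum_independent => v vW sum0 l _.
  have vE m : v m = delta m (v m m).
    have /memv_imgP[a aW ->] := vW m isT; rewrite lfunE.
    by congr delta; rewrite ffunE eqxx.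
  rewrite vE; have := congr1 (fun x : {ffun I -> L} => x l) sum0.
  rewrite sum_ffunE (bigD1 l) //= big1 ?addr0 => [->|m ml].
    by rewrite ffunE linear0.
  by rewrite vE ffunE eq_sym (negPf ml).
rewrite (directvP dir) /=; apply: eq_bigr => l _; apply: limg_dim_eq.
apply/eqP; rewrite -subv0; apply/subvP => a; rewrite memv_cap memv_ker lfunE /=.
case/andP=> _ /eqP/ffunP/(_ l); rewrite !ffunE eqxx => ->; exact: mem0v.
Qed.

Definition stable (U : {vspace {ffun I -> L}}) : Prop :=
  forall a x, x \in U -> lact a x \in U.

(** For a = e_i the dimension is the multiplicity of S_i as a composition factor of U, because e_i
    S_j is a line if i = j and zero otherwise. *)
Definition isotyp a (U : {vspace {ffun I -> L}}) := (linfun (lact a) @: U)%VS.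

Lemma isotypP e (U : {vspace {ffun I -> L}}) x : e * e = e -> stable U ->
  reflect (x \in U /\ lact e x = x) (x \in isotyp e U).
Proof.
move=> ee stU; apply: (iffP idP) => [/memv_imgP[y yU ->]|[xU ex]].
  by rewrite lfunE /= lactA ee; split=> //; apply: stU.
by apply/memv_imgP; exists x; rewrite ?lfunE.
Qed.

Lemma isotypS e (U V : {vspace {ffun I -> L}}) :
  (U <= V)%VS -> (isotyp e U <= isotyp e V)%VS.
Proof. exact: limgS. Qed.

Lemma isotyp_prodsp a (W : I -> {vspace L}) :
  isotyp a (prodsp W) = prodsp (fun l => amull a @: W l)%VS.
Proof.
apply/vspaceP => x; apply/idP/idP => [/memv_imgP[y /prodspP yW ->]|/prodspP xW].
  by apply/prodspP => l; rewrite lfunE ffunE; apply/memv_imgP; exists (y l);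
     rewrite ?lfunE.
have /choice[y yP] : forall l, exists b, b \in W l /\ x l = a * b.
  by move=> l; have /memv_imgP[b bW ->] := xW l; exists b; rewrite lfunE.
apply/memv_imgP; exists (finfun y).
  by apply/prodspP => l; rewrite ffunE; have [] := yP l.
by rewrite lfunE; apply/ffunP => l; rewrite !ffunE; have [] := yP l.
Qed.

Variable J : {vspace L}.

Definition idmul (U : {vspace {ffun I -> L}}) : {vspace {ffun I -> L}} :=
  (\sum_(b <- vbasis J) linfun (lact b) @: U)%VS.

Lemma idmul_sub (U W : {vspace {ffun I -> L}}) :
  (forall a x, a \in J -> x \in U -> lact a x \in W) -> (idmul U <= W)%VS.
Proof.
move=> JU; rewrite /idmul big_seq; elim/big_rec: _ => [|b V bJ VW].
  exact: sub0v.
rewrite subv_add VW andbT; apply/subvP => _ /memv_imgP[x xU ->].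
by rewrite lfunE; apply: JU => //; apply: vbasis_mem.
Qed.

Lemma mem_idmul (U : {vspace {ffun I -> L}}) a x :
  a \in J -> x \in U -> lact a x \in idmul U.
Proof.
move=> aJ xU; rewrite (coord_vbasis aJ) -[lact _ x]/(lactl x _) linear_sum.
apply: rpred_sum => i _ /=; rewrite lactZl; apply: rpredZ.
apply: (subvP (_ : linfun (lact (vbasis J)`_i) @: U <= _)%VS); last first.
  by apply/memv_imgP; exists x; rewrite ?lfunE.
rewrite /idmul (big_nth 0) big_mkord size_tuple.
exact: (sumv_sup i).
Qed.

Lemma idmul_stable U : left_ideal J -> stable (idmul U).
Proof.
move=> leftJ a x xU; rewrite -[lact a x](lfunE (lact a)).
have: x \in (linfun (lact a) @^-1: idmul U)%VS; last by rewrite memv_preim.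
apply: (subvP (idmul_sub _)) xU => b y bJ yU.
by rewrite -memv_preim lfunE /= lactA mem_idmul // leftJ.
Qed.

End OneModule.

Definition mulB (I I' : finType) (x : {ffun I -> L}) (B : I -> {ffun I' -> L}) :
  {ffun I' -> L} := \sum_l lact (x l) (B l).

Lemma mulB_linear (I I' : finType) (B : I -> {ffun I' -> L}) :
  linear (fun x => mulB x B).
Proof.
move=> c x y; rewrite /mulB scaler_sumr -big_split; apply: eq_bigr => l _ /=.
by rewrite !ffunE lactDl lactZl.
Qed.
Definition mulBl (I I' : finType) (B : I -> {ffun I' -> L}) :
  {linear {ffun I -> L} -> {ffun I' -> L}} := linear_of (mulB_linear B).

Lemma mulB_lact (I I' : finType) a x (B : I -> {ffun I' -> L}) :
  mulB (lact a x) B = lact a (mulB x B).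
Proof.
by rewrite /mulB linear_sum /=; apply: eq_bigr => l _; rewrite ffunE lactA.
Qed.

Lemma mulB_delta (I I' : finType) l a (B : I -> {ffun I' -> L}) :
  mulB (delta l a) B = lact a (B l).
Proof.
rewrite /mulB (bigD1 l) //= big1 ?addr0 ?ffunE ?eqxx // => m ml.
by rewrite ffunE (negPf ml) lact0l.
Qed.

Lemma mulBA (I I' I'' : finType) (x : {ffun I -> L}) (B : I -> {ffun I' -> L})
    (C : I' -> {ffun I'' -> L}) :
  mulB (mulB x B) C = mulB x (fun l => mulB (B l) C).
Proof.
rewrite -[LHS]/(mulBl C (\sum_l lact (x l) (B l))) linear_sum; apply: eq_bigr => l _ /=.
by rewrite mulB_lact.
Qed.

End FreeModules.

(** * Projective covers *)

Section Covers.

Variables (K : fieldType) (L : falgType K) (J : {vspace L}).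
Hypotheses (JL : left_ideal J) (JR : right_ideal J).
Hypothesis J3 : forall a b c, a \in J -> b \in J -> c \in J -> a * b * c = 0.
Variables (n : nat) (e : 'I_n -> L).
Hypotheses (ee : forall i, e i * e i = e i).
Hypothesis e_local : forall i x, exists c, e i * x * e i - c *: e i \in J.
Hypothesis e_orth : forall i j x, i != j -> e j * x * e i \in J.
Hypothesis e_gen : forall W : {vspace L},
  (forall a i b, a * e i * b \in W) -> W = fullv.

(** With Q the product of the L e_{j l}, the choices [fullv], [J] and [J * J] for X give Q, J Q and
    J^2 Q. *)
Definition projsp (X : {vspace L}) (I : finType) (j : I -> 'I_n) :
    {vspace {ffun I -> L}} :=
  prodsp (fun l => amulr (e (j l)) @: X)%VS.

Lemma projspP (X : {vspace L}) (I : finType) (j : I -> 'I_n)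
    (x : {ffun I -> L}) : right_ideal X ->
  reflect (forall l, x l \in X /\ x l * e (j l) = x l) (x \in projsp X j).
Proof.
move=> XR; apply: (iffP (prodspP _ _)) => xP l; have := xP l.
  by case/memv_imgP=> a aX ->; rewrite lfunE /= -mulrA ee; split=> //; apply: XR.
by case=> xX xe; apply/memv_imgP; exists (x l); rewrite ?lfunE.
Qed.

Lemma projsp_stable (X : {vspace L}) (I : finType) (j : I -> 'I_n) :
  left_ideal X -> right_ideal X -> stable (projsp X j).
Proof.
move=> XL XR a x /(projspP _ _ XR) xP; apply/projspP => // l; rewrite ffunE.
by have [xX xe] := xP l; split; [apply: XL|rewrite -mulrA xe].
Qed.

Lemma projspS (X Y : {vspace L}) (I : finType) (j : I -> 'I_n) :
  right_ideal X -> right_ideal Y -> (X <= Y)%VS -> (projsp X j <= projsp Y j)%VS.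
Proof.
move=> XR YR /subvP XY; apply/subvP => x /(projspP _ _ XR) xP.
by apply/projspP => // l; have [xX xe] := xP l; split=> //; apply: XY.
Qed.

Lemma fullL : left_ideal (fullv : {vspace L}).
Proof. by move=> a x _; apply: memvf. Qed.
Lemma fullR : right_ideal (fullv : {vspace L}).
Proof. by move=> a x _; apply: memvf. Qed.

Notation J2 := (J * J)%VS.

Lemma J2L : left_ideal J2.
Proof.
move=> a x xJ; have: x \in (amull a @^-1: J2)%VS.
  apply: (subvP (_ : J2 <= _)%VS) xJ; apply/prodvP => u v uJ vJ.
  by rewrite -memv_preim lfunE /= mulrA memv_mul ?JL.
by rewrite -memv_preim lfunE.
Qed.

Lemma J2R : right_ideal J2.
Proof.
move=> a x xJ; have: x \in (amulr a @^-1: J2)%VS.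
  apply: (subvP (_ : J2 <= _)%VS) xJ; apply/prodvP => u v uJ vJ.
  by rewrite -memv_preim lfunE /= -mulrA memv_mul ?JR.
by rewrite -memv_preim lfunE.
Qed.

Lemma J2J (a b : L) : a \in J2 -> b \in J -> a * b = 0.
Proof.
move=> aJ bJ; apply/eqP; have: a \in lker (amulr b).
  apply: (subvP (_ : J2 <= _)%VS) aJ; apply/prodvP => u v uJ vJ.
  by rewrite memv_ker lfunE /= J3.
by rewrite memv_ker lfunE.
Qed.

Lemma J2_sub : (J2 <= J)%VS.
Proof. by apply/prodvP => u v uJ vJ; apply: JL. Qed.

Lemma mulB_stable (I I' : finType) (U : {vspace {ffun I' -> L}})
    (B : I -> {ffun I' -> L}) x : stable U -> (forall l, B l \in U) -> mulB x B \in U.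
Proof. by move=> stU BU; apply: rpred_sum => l _; apply: stU. Qed.

(** The e_i generate L as a two-sided ideal, so U is spanned by the submodules L e_i U. *)
Lemma stable_generated (I : finType) (U W : {vspace {ffun I -> L}}) :
  stable U -> stable W -> (forall i x, x \in U -> lact (e i) x \in W) ->
  (U <= W)%VS.
Proof.
move=> stU stW UW; apply/subvP => x xU; rewrite -[x]lact1.
have W1 : (linfun (lactl x) @^-1: W)%VS = fullv.
  apply: e_gen => a i b; rewrite -memv_preim lfunE /= -!lactA.
  by apply: stW; apply: UW; apply: stU.
by have := memvf (1 : L); rewrite -W1 -memv_preim lfunE.
Qed.

(** Multiplying the inclusion by J^2 removes the error term since J^3 = 0, so J^2 U is in W; then J
    U is in W, then U. *)
Lemma nakayama (I : finType) (U W : {vspace {ffun I -> L}}) : stable U ->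
  stable W -> (U <= W + idmul J U)%VS -> (U <= W)%VS.
Proof.
move=> stU stW /subvP UW.
have ker a b z : a \in J -> b \in J -> z \in idmul J U -> lact (a * b) z = 0.
  move=> aJ bJ zU; apply/eqP; rewrite -[lact _ z](lfunE (lact _)) -memv_ker.
  apply: (subvP (idmul_sub _)) zU => c x cJ xU.
  by rewrite memv_ker lfunE /= lactA J3 // lact0l.
have W2 a b x : a \in J -> b \in J -> x \in U -> lact (a * b) x \in W.
  move=> aJ bJ /UW/memv_addP[y yW [z zU ->]].
  by rewrite linearD /= (ker _ _ z) // addr0 stW.
have W1 a x : a \in J -> x \in U -> lact a x \in W.
  move=> aJ /UW/memv_addP[y yW [z zU ->]]; rewrite linearD /=.
  apply: rpredD; first exact: stW.
  rewrite -[lact _ z](lfunE (lact _)) memv_preim.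
  apply: (subvP (idmul_sub _)) zU => c x' cJ xU.
  by rewrite -memv_preim lfunE /= lactA W2.
have /subvP JUW : (idmul J U <= W)%VS by apply: idmul_sub.
by apply/subvP => x /UW/memv_addP[y yW [z zU ->]]; apply: rpredD => //; apply: JUW.
Qed.

(** A projective cover of U given by generators [u l]. [cover_count] says that the number of
    generators of index i is the multiplicity of S_i in the top U / J U. *)
Record cover_spec (I I' : finType) (U : {vspace {ffun I -> L}}) (j : I' -> 'I_n)
    (u : I' -> {ffun I -> L}) : Prop := CoverSpec {
  cover_in : forall l, u l \in U;
  cover_idem : forall l, lact (e (j l)) (u l) = u l;
  cover_surj : forall x, x \in U -> exists2 y, y \in projsp fullv j & mulB y u = x;
  cover_rad : forall y, y \in projsp fullv j -> mulB y u \in idmul J U ->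
    y \in projsp J j;
  cover_count : forall i, (\sum_l (j l == i) + \dim (isotyp (e i) (idmul J U)) =
    \dim (isotyp (e i) U))%N }.

Section CoverConstruction.

Variables (I : finType) (U : {vspace {ffun I -> L}}).
Hypothesis stU : stable U.

Let JU := idmul J U.
Let stJU : stable JU := idmul_stable JL.
(** A lift of e_i (U / J U); bases of these spaces serve as generators. *)
Let D i := (isotyp (e i) U :\: isotyp (e i) JU)%VS.
Let T : finType := {i : 'I_n & 'I_(\dim (D i))}.
Let j (p : T) : 'I_n := tag p.
Let u (p : T) : {ffun I -> L} := (vbasis (D (tag p)))`_(tagged p).

Lemma idmul_subU : (JU <= U)%VS.
Proof. by apply: idmul_sub => a x _; apply: stU. Qed.

Lemma cover_mem (p : T) : u p \in D (j p).
Proof. by apply: vbasis_mem; rewrite mem_nth // size_tuple. Qed.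

Lemma cover_memU (p : T) : u p \in U /\ lact (e (j p)) (u p) = u p.
Proof.
by apply/isotypP => //; apply: (subvP (diffvSl _ _)) (cover_mem p).
Qed.

Lemma big_tag (R : Type) (idx : R) (op : Monoid.com_law idx) (i : 'I_n)
    (F : T -> R) :
  \big[op/idx]_(p | j p == i) F p =
  \big[op/idx]_(k < \dim (D i)) F (Tagged (fun i => 'I_(\dim (D i))) k).
Proof.
transitivity (\big[op/idx]_(i' | i' == i)
    \big[op/idx]_(k < \dim (D i')) F (Tagged (fun i => 'I_(\dim (D i))) k)).
  rewrite (@sig_big_dep _ _ op _ (fun i => 'I_(\dim (D i))) (pred1 i)
    (fun _ => predT) (fun i' k => F (Tagged (fun i => 'I_(\dim (D i))) k))).
  by apply: eq_big => [p|[i' k] _] //=; rewrite andbT.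
by rewrite big_pred1_eq.
Qed.

Let img := (linfun (mulBl u) @: projsp fullv j)%VS.

Lemma cover_img_stable : stable img.
Proof.
move=> a _ /memv_imgP[y yQ ->]; apply/memv_imgP; exists (lact a y).
  by apply: projsp_stable yQ; [exact: fullL|exact: fullR].
by rewrite !lfunE /= mulB_lact.
Qed.

Lemma delta_projsp (p : T) : delta p (e (j p)) \in projsp fullv j.
Proof.
apply/projspP => [|q]; first exact: fullR.
split; first exact: memvf.
by rewrite ffunE; case: eqP => [->|]; rewrite ?ee ?mul0r.
Qed.

Lemma cover_img : (U <= img)%VS.
Proof.
apply: nakayama => //; first exact: cover_img_stable.
apply: stable_generated => // [a x /memv_addP[y yW [z zU ->]]|i x xU].
  by rewrite linearD memv_add //; [exact: cover_img_stable|exact: stJU].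
have: lact (e i) x \in isotyp (e i) U by apply/memv_imgP; exists x; rewrite ?lfunE.
rewrite -(addv_diff_cap (isotyp (e i) U) (isotyp (e i) JU)) => /memv_addP[y yD [z]].
rewrite memv_cap => /andP[_ /isotypP[] // zU _] ->.
rewrite memv_add // (coord_vbasis yD) rpred_sum // => k _; apply: rpredZ.
pose p : T := Tagged (fun i => 'I_(\dim (D i))) k.
apply/memv_imgP; exists (delta p (e (j p))); first exact: delta_projsp.
by rewrite lfunE /= mulB_delta; have [_ ->] := cover_memU p.
Qed.

(** Modulo J, each e_i b y_m is a multiple c_m e_i, with c_m = 0 unless m has index i. Then the sum
    of the c_m u_m lies in J U and in its complement [D i], so it is 0, and all c_m vanish by
    freeness. As i and b vary, this puts every y_l into J. *)
Lemma cover_radical y : y \in projsp fullv j -> mulB y u \in JU ->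
  y \in projsp J j.
Proof.
move=> yQ yJ; apply/projspP => // l.
have /(projspP _ _ fullR) yP := yQ; have [_ yel] := yP l; split=> //.
suff /vspaceP/(_ 1) : (amulr (y l) @^-1: J)%VS = fullv.
  by rewrite memvf -memv_preim lfunE /= mul1r.
apply: e_gen => a i b; rewrite -memv_preim lfunE /= -!mulrA; apply: JL.
rewrite mulrA.
have /choice[c cP] : forall m, exists c, e i * b * y m -
    (if j m == i then c *: e i else 0) \in J.
  move=> m; have [_ ye] := yP m; rewrite -ye; case: eqP => [->|/eqP ji].
    have [c cJ] := e_local i (b * y m); exists c.
    by move: cJ; rewrite !mulrA.
  by exists 0; rewrite subr0 !mulrA -(mulrA (e i)) e_orth.
have sumJ : \sum_(m | j m == i) c m *: u m \in JU.
  have : lact (e i * b) (mulB y u) \in JU by apply: stJU.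
  have -> : lact (e i * b) (mulB y u) = \sum_(m | j m == i) c m *: u m +
      \sum_m lact (e i * b * y m - (if j m == i then c m *: e i else 0)) (u m).
    rewrite -mulB_lact [X in X + _]big_mkcond -big_split /=; apply: eq_bigr => m _.
    rewrite ffunE lactBl; case: eqP => [<-|_]; last by rewrite lact0l subr0 add0r.
    by rewrite lactZl; have [_ ->] := cover_memU m; rewrite addrC subrK.
  move=> sumJU; rewrite -(addrK (\sum_m lact (e i * b * y m -
    (if j m == i then c m *: e i else 0)) (u m)) (\sum_(m | _) _)).
  apply: rpredB => //; apply: rpred_sum => m _; apply: mem_idmul => //.
  by have [] := cover_memU m.
have sumE : \sum_(m | j m == i) c m *: u m = 0.
  apply/eqP; rewrite -memv0 -(capv_diff (isotyp (e i) U) (isotyp (e i) JU)).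
  rewrite memv_cap rpred_sum /= => [|m /eqP <-]; last by rewrite rpredZ ?cover_mem.
  apply/isotypP => //; split=> //; rewrite linear_sum; apply: eq_bigr => m /eqP <-.
  by rewrite linearZ /=; have [_ ->] := cover_memU m.
rewrite big_tag /= in sumE.
have /freeP/(_ _ sumE) c0 := basis_free (vbasisP (D i)).
have := cP l; case: eqP => [jl|_]; last by rewrite subr0.
have -> : c l = 0.
  case: l jl {yel cP} => i1 k; rewrite {1}/j /= => jl; subst i1; exact: (c0 k).
by rewrite scale0r subr0.
Qed.

Lemma cover_counts i : (\sum_l (j l == i) + \dim (isotyp (e i) JU) =
  \dim (isotyp (e i) U))%N.
Proof.
have -> : (\sum_l (j l == i) = \dim (D i))%N.
  rewrite (eq_bigr (fun l => if j l == i then 1%N else 0%N)); last first.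
    by move=> l _; case: eqP.
  by rewrite -big_mkcond /= big_tag sum1_card card_ord.
rewrite -(dimv_cap_compl (isotyp (e i) U) (isotyp (e i) JU)) addnC.
congr (\dim _ + _)%N; apply/esym/capv_idPr; apply: isotypS; exact: idmul_subU.
Qed.

Lemma cover_exists :
  exists (I' : finType) (j : I' -> 'I_n) (u : I' -> {ffun I -> L}),
    cover_spec U j u.
Proof.
exists T, j, u; split.
- by move=> l; have [] := cover_memU l.
- by move=> l; have [] := cover_memU l.
- by move=> x /(subvP cover_img)/memv_imgP[y yQ ->]; exists y; rewrite ?lfunE.
- exact: cover_radical.
- exact: cover_counts.
Qed.

End CoverConstruction.

End Covers.

(** * Minimal resolutions of simple modules *)

Section ConcreteResolution.

Variables (K : fieldType) (L : falgType K) (J : {vspace L}).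
Hypotheses (JL : left_ideal J) (JR : right_ideal J).
Hypothesis J3 : forall a b c, a \in J -> b \in J -> c \in J -> a * b * c = 0.
Variables (n : nat) (e : 'I_n -> L).
Hypotheses (ee : forall i, e i * e i = e i).
Hypothesis e_local : forall i x, exists c, e i * x * e i - c *: e i \in J.
Hypothesis e_orth : forall i j x, i != j -> e j * x * e i \in J.
Hypothesis e_gen : forall W : {vspace L},
  (forall a i b, a * e i * b \in W) -> W = fullv.

Section ProjectiveModule.

Variables (I : finType) (j : I -> 'I_n).

Lemma projsp_closed :
  submod_closed (fun x : {ffun I -> L^o} => (x : {ffun I -> L}) \in projsp e fullv j).
Proof.
split; first exact: mem0v.
move=> a x y xQ yQ; apply: memvD => //.
exact: (projsp_stable ee (@fullL _ _) (@fullR _ _)).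
Qed.

Definition projmod : lmodType L := submodule (Subpred projsp_closed).
Definition projval (x : projmod) : {ffun I -> L} := submodule_val x.
Definition projelt (x : {ffun I -> L}) (xQ : x \in projsp e fullv j) : projmod :=
  @Submodule _ _ (Subpred projsp_closed) x xQ.

Lemma projval_mem x : projval x \in projsp e fullv j.
Proof. exact: (submodule_valP x). Qed.

Lemma projval_inj : injective projval.
Proof. exact: val_inj. Qed.

Lemma projvalD x y : projval (x + y) = projval x + projval y.
Proof. by []. Qed.

Lemma projvalZ a x : projval (a *: x) = lact a (projval x).
Proof. by []. Qed.

Lemma projval_idem x l : projval x l * e (j l) = projval x l.
Proof. by have /(projspP ee _ _ (@fullR _ _))/(_ l)[] := projval_mem x. Qed.

Lemma delta_mem l : delta l (e (j l)) \in projsp e fullv j.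
Proof.
apply/(projspP ee); first exact: fullR.
move=> q; split; first exact: memvf.
by rewrite ffunE; case: eqP => [->|]; rewrite ?ee ?mul0r.
Qed.

Definition projgen l : projmod := projelt (delta_mem l).

Lemma projmod_sum (x : projmod) : x = \sum_l projval x l *: projgen l.
Proof.
apply: projval_inj; rewrite (big_morph projval projvalD (erefl : projval 0 = 0)).
rewrite {1}[projval x]sum_delta; apply: eq_bigr => l _.
by rewrite projvalZ lact_delta projval_idem.
Qed.

(** The coordinates of an element are canonical coefficients over the generators, so lifts of the
    generators can be chosen freely. *)
Lemma projmod_projective : projective_module projmod.
Proof.
move=> M N g f gsurj.
have /choice[m mP] : forall l, exists m, g m = f (projgen l) by move=> l; apply: gsurj.
pose h (x : projmod) := \sum_l projval x l *: m l.
have lh : linear h.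
  move=> a x y; rewrite /h scaler_sumr -big_split; apply: eq_bigr => l _.
  by rewrite projvalD projvalZ !ffunE scalerDl scalerA.
exists (linear_of lh) => x /=; rewrite /h linear_sum [in RHS](projmod_sum x) linear_sum.
by apply: eq_bigr => l _; rewrite !linearZ /= mP.
Qed.

(** Each generator is in U up to some v_l in J Q. Replacing generators by these representatives
    moves the coordinates of the error from L to J, from J to J^2 and from J^2 to 0. *)
Lemma projmod_superfluous (N : lmodType L) (f : {linear projmod -> N}) :
  (forall x, f x = 0 -> projval x \in projsp e J j) -> superfluous_kernel f.
Proof.
move=> kerJ U [U0 clU] UP.
have clsum (a : I -> L) (x : I -> projmod) : (forall l, x l \in U) ->
    \sum_l a l *: x l \in U.
  move=> xU; elim/big_rec: _ => // l y _ yU; exact: clU.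
have /choice[v vP] : forall l, exists v, projgen l - v \in U /\
    (projval v \in projsp e J j).
  move=> l; have [u [v [uU fv ->]]] := UP (projgen l).
  by exists v; rewrite addrK; split=> //; apply: kerJ.
have step (X Y : {vspace L}) : right_ideal X ->
    (forall x : projmod, (forall l, projval x l \in Y) -> x \in U) ->
    (forall a b, a \in X -> b \in J -> a * b \in Y) ->
    forall x : projmod, (forall l, projval x l \in X) -> x \in U.
  move=> XR YU XY x xX.
  have -> : x = 1 *: (\sum_l projval x l *: (projgen l - v l)) +
      \sum_l projval x l *: v l.
    rewrite scale1r -big_split {1}(projmod_sum x); apply: eq_bigr => l _ /=.
    by rewrite -scalerDr subrK.
  apply: clU; first by apply: clsum => l; have [] := vP l.
  apply: YU => m; rewrite (big_morph projval projvalD (erefl : projval 0 = 0)).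
  rewrite sum_ffunE; apply: rpred_sum => l _; rewrite projvalZ ffunE.
  by apply: XY => //; have [_ /(projspP ee _ _ JR)/(_ m)[]] := vP l.
have U2 : forall x : projmod, (forall l, projval x l \in (J * J)%VS) -> x \in U.
  apply: (step (J * J)%VS 0%VS); first exact: J2R.
    move=> x x0; suff -> : x = 0 by [].
    apply: projval_inj; apply/ffunP => l; have := x0 l; rewrite memv0 => /eqP->.
    by rewrite -[projval 0]/(0 : {ffun I -> L}) ffunE.
  by move=> a b aJ bJ; rewrite (J2J J3 aJ bJ) mem0v.
have U1 : forall x : projmod, (forall l, projval x l \in J) -> x \in U.
  by apply: (step J (J * J)%VS) => // a b aJ bJ; apply: memv_mul.
move=> x; apply: (step fullv J) => // [|a b _ bJ|l]; [exact: fullR|exact: JL|exact: memvf].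
Qed.

End ProjectiveModule.

(* A stage of a minimal resolution: the projective module prod_l L e_{j l} and,
   inside it, the syzygy U to be covered next. *)
Record state := State {
  st_ix : finType;
  st_j : st_ix -> 'I_n;
  st_U : {vspace {ffun st_ix -> L}};
  st_stable : stable st_U;
  st_sub : (st_U <= projsp e J st_j)%VS }.

Section Next.

Variable s : state.

Let ex := cid (cover_exists JL JR J3 ee e_local e_orth e_gen (@st_stable s)).
Definition cov_ix : finType := projT1 ex.
Let ex2 := cid (projT2 ex).
Definition cov_j : cov_ix -> 'I_n := projT1 ex2.
Let ex3 := cid (projT2 ex2).
Definition cov_u : cov_ix -> {ffun st_ix s -> L} := projT1 ex3.
Lemma covP : cover_spec J e (st_U s) cov_j cov_u.
Proof. exact: (projT2 ex3). Qed.

Definition next_U : {vspace {ffun cov_ix -> L}} :=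
  (projsp e fullv cov_j :&: lker (linfun (mulBl cov_u)))%VS.

Lemma next_UP x : reflect (x \in projsp e fullv cov_j /\ mulB x cov_u = 0)
  (x \in next_U).
Proof.
rewrite memv_cap memv_ker lfunE /=.
by apply: (iffP andP) => -[xQ /eqP xu]; split=> //; apply/eqP.
Qed.

Lemma next_stable : stable next_U.
Proof.
move=> a x /next_UP[xQ xu]; apply/next_UP; split.
  exact: (projsp_stable ee (@fullL _ _) (@fullR _ _)).
by rewrite mulB_lact xu linear0.
Qed.

Lemma next_sub : (next_U <= projsp e J cov_j)%VS.
Proof.
apply/subvP => x /next_UP[xQ xu].
by apply: (cover_rad covP) => //; rewrite xu mem0v.
Qed.

Definition next : state := State next_stable next_sub.

End Next.

Definition stmod (s : state) : lmodType L := projmod (@st_j s).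

Lemma st_sub_full (s : state) (x : {ffun st_ix s -> L}) :
  x \in st_U s -> x \in projsp e fullv (@st_j s).
Proof.
move=> xU; apply: (subvP (projspS ee _ JR (@fullR _ _) (subvf _))).
exact: (subvP (st_sub s)).
Qed.

Lemma next_diff_mem (s : state) (x : {ffun cov_ix s -> L}) :
  mulB x (@cov_u s) \in st_U s.
Proof. exact: (mulB_stable _ (@st_stable s) (cover_in (covP s))). Qed.

Definition next_diff_fun (s : state) (x : stmod (next s)) : stmod s :=
  projelt (st_sub_full (next_diff_mem (projval x))).

Lemma next_diff_linear s : linear (@next_diff_fun s).
Proof.
move=> a x y; apply: projval_inj; rewrite projvalD projvalZ /=.
rewrite /projval /= -[LHS]/(mulBl (@cov_u s) (lact a (projval x) + projval y)).
by rewrite linearD /= mulB_lact.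
Qed.

Definition next_diff s : {linear stmod (next s) -> stmod s} :=
  linear_of (@next_diff_linear s).

Lemma next_diffE s x : projval (next_diff s x) = mulB (projval x) (@cov_u s).
Proof. by []. Qed.

Lemma next_diff_image s (y : stmod s) :
  (exists x, next_diff s x = y) <-> projval y \in st_U s.
Proof.
split=> [[x <-]|yU]; first by rewrite next_diffE next_diff_mem.
have [x xQ xy] := cover_surj (covP s) yU.
by exists (projelt xQ); apply: projval_inj; rewrite next_diffE.
Qed.

Lemma next_diff_kernel s (x : stmod (next s)) :
  next_diff s x = 0 <-> projval x \in next_U s.
Proof.
split=> [/(congr1 (@projval _ _))|/next_UP[_ xu]].
  by rewrite next_diffE => xu; apply/next_UP; split=> //; apply: projval_mem.
by apply: projval_inj; rewrite next_diffE xu.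
Qed.

Variables (S : lmodType L) (t : S) (i : 'I_n).
Hypothesis t_gen : forall x, exists a : L, a *: t = x.
Hypothesis t_ann : forall a : L, a *: t = 0 <-> a * e i \in J.

Lemma start_stable : stable (projsp e J (fun _ : unit => i)).
Proof. exact: (projsp_stable ee JL JR). Qed.

Definition start : state := State start_stable (subvv _).

Lemma start_aug_linear : linear (fun x : stmod start => projval x tt *: t).
Proof. by move=> a x y; rewrite projvalD projvalZ !ffunE scalerDl scalerA. Qed.

Definition start_aug : {linear stmod start -> S} := linear_of start_aug_linear.

Lemma start_aug_kernel (x : stmod start) :
  start_aug x = 0 <-> projval x \in projsp e J (fun _ : unit => i).
Proof.
rewrite /= t_ann projval_idem; split=> [xJ|/(projspP ee _ _ JR)/(_ tt)[]] //.
by apply/(projspP ee _ _ JR) => -[]; split=> //; apply: projval_idem.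
Qed.

Lemma start_aug_surj : surjective_map start_aug.
Proof.
move=> y; have [a <-] := t_gen y; exists (a *: projgen (fun _ : unit => i) tt).
rewrite linearZ; congr (_ *: _).
rewrite -[LHS]/(delta tt (e i) tt *: t) ffunE eqxx.
apply/eqP; rewrite -subr_eq0 -{2}[t]scale1r -scalerBl; apply/eqP/t_ann.
by rewrite mulrBl ee mul1r subrr mem0v.
Qed.

(** Off by one: [stage k] consists of the k-th projective term and the (k+1)-st syzygy inside it,
    starting with J e_i in L e_i. *)
Definition stage k : state := iter k next start.

Lemma stage_exact0 (x : stmod start) :
  start_aug x = 0 <-> exists y, next_diff start y = x.
Proof. by rewrite start_aug_kernel next_diff_image. Qed.

Lemma stage_exactS k (x : stmod (stage k.+1)) :
  next_diff (stage k) x = 0 <-> exists y, next_diff (stage k.+1) y = x.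
Proof. by rewrite next_diff_kernel next_diff_image. Qed.

Definition simple_resolution : projective_resolution S :=
  @ProjectiveResolution _ S (fun k => stmod (stage k))
    (fun k => next_diff (stage k)) start_aug
    (fun k => @projmod_projective _ _) start_aug_surj stage_exact0 stage_exactS.

Lemma simple_resolution_minimal : minimal_resolution simple_resolution.
Proof.
split=> [|k]; apply: projmod_superfluous => x; first by rewrite start_aug_kernel.
by move/next_diff_kernel; apply/subvP; apply: next_sub.
Qed.

End ConcreteResolution.

(** * Stable endomorphisms of syzygies *)

Section Frobenius.

Variables (K : fieldType) (L : falgType K) (nu : {scalar L}).
Hypothesis nu_nondeg : forall x, (forall a, nu (a * x) = 0) -> x = 0.

Lemma functional_rep (f : {scalar L}) : exists b, forall y, f y = nu (y * b).
Proof.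
pose X := vbasis {:L}; pose m := \dim {:L}.
pose g (b : L) : 'rV[K]_m := \row_k nu (X`_k * b).
have lg : linear g.
  by move=> a y z; apply/rowP => k; rewrite !mxE mulrDr linearD -scalerAr linearZ.
pose gl : 'Hom(L, 'rV[K]_m) := linfun (linear_of lg).
have spanX y : y = \sum_(k < m) coord X k y *: X`_k by apply: coord_vbasis (memvf y).
have ker0 : lker gl = 0%VS.
  apply/eqP; rewrite -subv0; apply/subvP => b; rewrite memv_ker lfunE /= memv0.
  move=> /eqP/rowP gb; apply/eqP/nu_nondeg => a; rewrite (spanX a) mulr_suml linear_sum.
  rewrite big1 // => k _; rewrite -scalerAl linearZ /=.
  by have := gb k; rewrite !mxE => ->; rewrite mulr0.
have im1 : limg gl = fullv.
  apply/eqP; rewrite eqEdim subvf /=; have := limg_ker_dim gl fullv.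
  rewrite capfv ker0 dimv0 add0n => ->.
  by rewrite -/m dimvf /dim /= mul1n.
have : (\row_k f X`_k : 'rV[K]_m) \in limg gl by rewrite im1 memvf.
case/memv_imgP=> b _; rewrite lfunE /= => /rowP fb; exists b => y.
rewrite (spanX y) mulr_suml !linear_sum; apply: eq_bigr => k _.
by rewrite -scalerAl !linearZ /=; have := fb k; rewrite !mxE => ->.
Qed.

Lemma functional_rep_ffun (I : finType) (f : {scalar {ffun I -> L}}) :
  exists b : I -> L, forall x, f x = nu (\sum_l x l * b l).
Proof.
have lf l : linear_for *%R (f \o delta l) by move=> a x y; rewrite /= !linearP.
have /choice[b bP] : forall l, exists b, forall y, f (delta l y) = nu (y * b).
  move=> l; pose fl : {scalar L} :=
    HB.pack (f \o delta l) (GRing.isLinear.Build K L K *%R (f \o delta l) (lf l)).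
  exact: (functional_rep fl).
exists b => x; rewrite {1}(sum_delta x) !linear_sum.
by apply: eq_bigr => l _; rewrite /= bP.
Qed.

(* Free modules are injective, so every homomorphism between submodules of free
   modules is given by a matrix. *)
Lemma matrix_rep (I I' : finType) (U : {vspace {ffun I -> L}})
    (g : {linear {ffun I -> L} -> {ffun I' -> L}}) :
  stable U -> (forall a x, x \in U -> g (lact a x) = lact a (g x)) ->
  exists B, forall x, x \in U -> g x = mulB x B.
Proof.
move=> stU gact.
have /choice[b bP] : forall m, exists b : I -> L, forall x,
    nu (g x m) = nu (\sum_l x l * b l).
  move=> m; have lgm : linear_for *%R (fun x => nu (g x m)).
    by move=> a x y; rewrite linearP !ffunE linearP.
  pose f : {scalar {ffun I -> L}} :=
    HB.pack (fun x => nu (g x m)) (GRing.isLinear.Build K _ K *%R _ lgm).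
  exact: (functional_rep_ffun f).
exists (fun l => [ffun m => b m l]) => x xU; apply/ffunP => m; apply/eqP.
rewrite -subr_eq0; apply/eqP/nu_nondeg => a.
have -> : mulB x (fun l => [ffun m => b m l]) m = \sum_l x l * b m l.
  by rewrite sum_ffunE; apply: eq_bigr => l _; rewrite !ffunE.
have -> : a * (g x m - \sum_l x l * b m l) = g (lact a x) m - \sum_l lact a x l * b m l.
  rewrite gact // mulrBr ffunE mulr_sumr; congr (_ - _).
  by apply: eq_bigr => l _; rewrite ffunE mulrA.
by rewrite linearB /= bP subrr.
Qed.

End Frobenius.

(** * Stable endomorphism rings along a resolution *)

Section Syzygies.

Variables (K : fieldType) (L : falgType K) (J : {vspace L}).
Hypotheses (JL : left_ideal J) (JR : right_ideal J).
Hypothesis J3 : forall a b c, a \in J -> b \in J -> c \in J -> a * b * c = 0.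
Variables (n : nat) (e : 'I_n -> L).
Hypotheses (ee : forall i, e i * e i = e i).
Hypothesis e_local : forall i x, exists c, e i * x * e i - c *: e i \in J.
Hypothesis e_orth : forall i j x, i != j -> e j * x * e i \in J.
Hypothesis e_gen : forall W : {vspace L},
  (forall a i b, a * e i * b \in W) -> W = fullv.
Variable nu : {scalar L}.
Hypothesis nu_nondeg : forall x, (forall a, nu (a * x) = 0) -> x = 0.

Notation J2 := (J * J)%VS.
Notation state := (state J e).
Notation next := (next JL JR J3 ee e_local e_orth e_gen).
Notation covP s := (covP JL JR J3 ee e_local e_orth e_gen s).
Notation cov_u := (@cov_u _ _ _ JL JR J3 _ _ ee e_local e_orth e_gen _).
Notation cov_j := (@cov_j _ _ _ JL JR J3 _ _ ee e_local e_orth e_gen _).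

(* Every endomorphism of the syzygy U is a scalar up to a map that factors
   through the projective module containing it. *)
Definition stably_scalar (s : state) : Prop :=
  forall B : st_ix s -> {ffun st_ix s -> L},
    (forall x, x \in st_U s -> mulB x B \in st_U s) ->
  exists c B', (forall x, x \in projsp e fullv (@st_j _ _ _ _ _ s) ->
      mulB x B' \in st_U s) /\
    forall x, x \in st_U s -> mulB x B = c *: x + mulB x B'.

(** An endomorphism of J e_i is right multiplication by c e_i + d with d in J, and multiplication by
    d already maps L e_i into J e_i. *)
Lemma stably_scalar_start i : stably_scalar (start JL JR ee i).
Proof.
move=> B BU; set b := B tt tt; have [c cJ] := e_local i b.
pose d := e i * b * e i - c *: e i.
have de : d * e i = d by rewrite /d mulrBl -!mulrA ee -scalerAl ee.
have mulE x (C : unit -> {ffun unit -> L}) : mulB x C tt = x tt * C tt tt.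
  by rewrite /mulB sum_ffunE (bigD1 tt) //= big1 ?addr0 ?ffunE // => -[].
exists c, (fun _ => [ffun _ => d]); split=> x /=.
  move=> /(projspP ee _ _ (@fullR _ _))/(_ tt)[_ xe].
  apply/(projspP ee _ _ JR) => -[]; rewrite mulE ffunE; split; last by rewrite -mulrA de.
  exact: JL.
move=> xU; have /(projspP ee _ _ JR)/(_ tt)[xJ xe] := xU.
have /(projspP ee _ _ JR)/(_ tt)[_] := BU x xU; rewrite mulE -/b => be.
apply/ffunP => -[]; rewrite mulE -/b !ffunE mulE ffunE /d mulrBr -scalerAr.
by rewrite !mulrA xe be addrC subrK.
Qed.

(** Extend an endomorphism of the kernel U' of the cover Q' of U to Q'. It induces an endomorphism
    of U, which is a scalar c up to a map through the projective module around U. Lifting that map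
    to Q' and subtracting both corrections leaves a map from Q' to U'. *)
Lemma stably_scalar_next (s : state) : stably_scalar s -> stably_scalar (next s).
Proof.
move=> scal B BU; have cov := covP s.
pose u : st_ix (next s) -> {ffun st_ix s -> L} := cov_u.
pose j' : st_ix (next s) -> 'I_n := cov_j.
have stQ' : stable (projsp e fullv j').
  exact: (projsp_stable ee (@fullL _ _) (@fullR _ _)).
have UP x : reflect (x \in projsp e fullv j' /\ mulB x u = 0) (x \in st_U (next s)).
  exact: (@next_UP _ _ _ JL JR J3 _ _ ee e_local e_orth e_gen s x).
(* Cutting by idempotents forces values in Q' and changes nothing on U'. *)
pose B2 l : {ffun _ -> L} := [ffun m => B l m * e (j' m)].
have B2E x m : mulB x B2 m = mulB x B m * e (j' m).
  by rewrite !sum_ffunE mulr_suml; apply: eq_bigr => l _; rewrite !ffunE mulrA.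
have B2Q x : mulB x B2 \in projsp e fullv j'.
  apply/(projspP ee _ _ (@fullR _ _)) => m; split; first exact: memvf.
  by rewrite B2E -mulrA ee.
have B2U x : x \in st_U (next s) -> mulB x B2 = mulB x B.
  move=> xU; apply/ffunP => m; rewrite B2E.
  by have /UP[/(projspP ee _ _ (@fullR _ _))/(_ m)[]] := BU x xU.
(* [sg] is only a K-linear section of the cover; the induced map [g] does not depend on it, which
   makes it L-linear on U. *)
pose h := (linfun (mulBl u) \o projv (projsp e fullv j'))%VF.
pose sg y := projv (projsp e fullv j') ((h^-1)%VF y).
have sgQ y : sg y \in projsp e fullv j' by apply: memv_proj.
have sgK y : y \in st_U s -> mulB (sg y) u = y.
  move=> yU; have [x xQ xy] := cover_surj cov yU.
  have yh : y \in limg h.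
    apply/memv_imgP; exists x; first exact: memvf.
    by rewrite comp_lfunE projv_id // lfunE /= -xy.
  by rewrite -[RHS](limg_lfunVK yh) comp_lfunE lfunE.
have inU x : mulB x u \in st_U s.
  exact: (mulB_stable _ (@st_stable _ _ _ _ _ s) (cover_in cov)).
pose g y := mulB (mulB (sg y) B2) u.
have lg : linear g.
  move=> a x y; rewrite /g /sg !linearP.
  rewrite -[mulB (a *: _ + _) B2]/(mulBl B2 _) linearP.
  by rewrite -[mulB (a *: _ + _) u]/(mulBl u _) linearP.
have gE x : x \in projsp e fullv j' -> g (mulB x u) = mulB (mulB x B2) u.
  move=> xQ; apply/eqP; rewrite -subr_eq0 /g; apply/eqP.
  rewrite -[LHS]/(mulBl u _ - mulBl u _) -linearB.
  rewrite -[mulB _ B2 - _]/(mulBl B2 _ - mulBl B2 _) -linearB /=.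
  have dU : sg (mulB x u) - x \in st_U (next s).
    apply/UP; split; first by rewrite rpredB.
    by rewrite -[LHS]/(mulBl u _) linearB /= sgK ?subrr.
  by rewrite B2U //; have /UP[] := BU _ dU.
have [|a y yU|C CP] := @matrix_rep _ _ _ nu_nondeg _ _ (st_U s) (linear_of lg).
- exact: (@st_stable _ _ _ _ _ s).
- have [x xQ <-] := cover_surj cov yU; rewrite /= -mulB_lact !gE //.
    by rewrite !mulB_lact.
  exact: stQ'.
have [|c [C' [C'U C'E]]] := scal C.
  by move=> y yU; rewrite -CP //=; apply: inU.
(* The lift of C' through the cover. *)
have /choice[y yP] : forall l, exists y, y \in projsp e fullv j' /\
    mulB y u = mulB (delta l (e (st_j l))) C'.
  move=> l; have yU := C'U _ (delta_mem ee _ l).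
  by have [y yQ yE] := cover_surj cov yU; exists y.
have yC x : x \in projsp e fullv (@st_j _ _ _ _ _ s) -> mulB (mulB x y) u = mulB x C'.
  move=> /(projspP ee _ _ (@fullR _ _)) xP; rewrite mulBA; apply: eq_bigr => l _.
  by have [_ ->] := yP l; rewrite mulB_delta lactA; have [_ ->] := xP l.
pose H l := B2 l - c *: delta l 1 - mulB (u l) y.
have HE x : mulB x H = mulB x B2 - c *: x - mulB (mulB x u) y.
  rewrite mulBA {3}(sum_delta x) scaler_sumr -!sumrB; apply: eq_bigr => l _.
  by rewrite !linearB /= linearZ /= lact_delta mulr1.
exists c, H; split=> x xQ; last first.
  have /UP[_ xu] := xQ; rewrite HE xu -B2U //.
  rewrite -[mulB 0 y]/(mulBl y 0) linear0 subr0.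
  by rewrite addrC subrK.
apply/UP; rewrite HE; split.
  rewrite !rpredB ?rpredZ //.
  by apply: mulB_stable => // l; have [] := yP l.
rewrite -[LHS]/(mulBl u _) !linearB linearZ /=.
have xU := inU x; rewrite yC; last exact: st_sub_full.
by rewrite -gE // -[g _]/(linear_of lg _) CP // C'E // [_ - c *: _]addrC addKr subrr.
Qed.

End Syzygies.

(** * Radical layers *)

Section Socle.

Variables (K : fieldType) (L : falgType K) (J : {vspace L}).
Hypotheses (JL : left_ideal J) (JR : right_ideal J).
Hypothesis J3 : forall a b c, a \in J -> b \in J -> c \in J -> a * b * c = 0.
Variables (n : nat) (e : 'I_n -> L).
Hypotheses (ee : forall i, e i * e i = e i).
Hypothesis e_local : forall i x, exists c, e i * x * e i - c *: e i \in J.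
Hypothesis e_orth : forall i j x, i != j -> e j * x * e i \in J.
Hypothesis e_gen : forall W : {vspace L},
  (forall a i b, a * e i * b \in W) -> W = fullv.
Hypothesis e_notin : forall i, e i \notin J.
Variable nu : {scalar L}.
Hypothesis nuC : forall a b, nu (a * b) = nu (b * a).
Hypothesis nu_nondeg : forall x, (forall a, nu (a * x) = 0) -> x = 0.

Notation J2 := (J * J)%VS.

(** This is e_j X e_i, whose dimension counts S_j in X e_i; the order of the indices matches
    Ext^1(S_i, S_j). *)
Definition corner (X : {vspace L}) i j :=
  (amull (e j) @: (amulr (e i) @: X))%VS.

Hypothesis neighbour : forall i, exists2 j, i != j & corner J i j != 0%VS.

Lemma cornerP (X : {vspace L}) i j x : left_ideal X -> right_ideal X ->
  reflect [/\ x \in X, e j * x = x & x * e i = x] (x \in corner X i j).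
Proof.
move=> XL XR; apply: (iffP idP) => [|[xX ex xe]].
  case/memv_imgP=> y /memv_imgP[z zX ->] ->; rewrite lfunE /= lfunE /=.
  by split; [apply/XL/XR|rewrite !mulrA ee|rewrite -!mulrA ee].
apply/memv_imgP; exists x; rewrite ?lfunE //.
by apply/memv_imgP; exists x; rewrite ?lfunE.
Qed.

Lemma J2_socle a b : a \in J -> b \in J2 -> a * b = 0.
Proof.
move=> aJ bJ; apply/eqP; have: b \in lker (amull a).
  apply: (subvP (_ : J2 <= _)%VS) bJ; apply/prodvP => u v uJ vJ.
  by rewrite memv_ker lfunE /= mulrA J3.
by rewrite memv_ker lfunE.
Qed.

(** By symmetry nu(a x) = nu(e_i a e_j x), and e_i a e_j is in J. *)
Lemma socle_offdiag i j x : (forall a, a \in J -> a * x = 0) -> i != j ->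
  e j * x = x -> x * e i = x -> x = 0.
Proof.
move=> Jx ij ex xe; apply: nu_nondeg => a.
rewrite -xe mulrA nuC -ex !mulrA Jx ?mul0r ?linear0 //.
by apply: e_orth; rewrite eq_sym.
Qed.

(** Here nu(a x) = nu(e_i a e_i x) is a multiple of nu(x), because e_i a e_i is a multiple of e_i
    modulo J. So nu is injective on this part of the socle. *)
Lemma socle_diag i x : (forall a, a \in J -> a * x = 0) ->
  e i * x = x -> x * e i = x -> nu x = 0 -> x = 0.
Proof.
move=> Jx ex xe nux; apply: nu_nondeg => a; have [c cJ] := e_local i a.
rewrite -xe mulrA nuC -ex !mulrA.
have := Jx _ cJ; rewrite mulrBl => /eqP; rewrite subr_eq0 => /eqP->.
by rewrite -scalerAl ex linearZ /= nux mulr0.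
Qed.

(** Take a nonzero y in e_j J e_i with j different from i, and a with nu(a y) nonzero. Then e_i a
    e_j is also in J, so e_i a e_j y is in J^2 and has the same value under nu. *)
Lemma socle_generator i : exists2 z, z \in corner J2 i i & nu z != 0.
Proof.
have [j ij] := neighbour i; rewrite -vpick0.
set y := vpick _ => y0; have /cornerP[//|//|yJ ey ye] := memv_pick (corner J i j).
have [a nua] : exists a, nu (a * y) <> 0.
  by apply: contrapT => noa; case/eqP: y0; apply: nu_nondeg => a;
     apply: contrapT => ?; apply: noa; exists a.
exists (e i * a * e j * y).
  apply/cornerP; [exact: J2L|exact: J2R|split].
  - by apply: memv_mul => //; apply: e_orth; rewrite eq_sym.
  - by rewrite !mulrA ee.
  - by rewrite -mulrA ye.
by rewrite -!mulrA nuC -!mulrA ye ey; apply/eqP.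
Qed.

Lemma socle_line i z x : z \in corner J2 i i -> z != 0 -> x \in corner J2 i i ->
  exists c, x = c *: z.
Proof.
move=> /cornerP[]; [exact: J2L|exact: J2R|] => zJ ez ze z0.
move=> /cornerP[]; [exact: J2L|exact: J2R|] => xJ ex xe.
have nuz : nu z != 0.
  apply: contraNneq z0 => nuz; apply/eqP; apply: (@socle_diag i) => // a aJ.
  exact: J2_socle.
exists (nu x / nu z); apply/eqP; rewrite -subr_eq0; apply/eqP.
apply: (@socle_diag i) => [a aJ|||].
- by rewrite mulrBr -scalerAr !J2_socle // scaler0 subrr.
- by rewrite mulrBr -scalerAr ex ez.
- by rewrite mulrBl -scalerAl xe ze.
- by rewrite linearB linearZ /= divfK // subrr.
Qed.

(** Cut x by idempotents on both sides: the off-diagonal pieces vanish and the diagonal ones are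
    multiples of the generators in J^2. *)
Lemma socle_sub x : (forall a, a \in J -> a * x = 0) -> x \in J2.
Proof.
move=> Jx; suff W1 : (amulr x @^-1: J2)%VS = fullv.
  by have := memvf (1 : L); rewrite -W1 -memv_preim lfunE /= mul1r.
apply: e_gen => a j b; rewrite -memv_preim lfunE /= -!mulrA; apply: (J2L JL).
suff W1 : (amull (e j * (b * x)) @^-1: J2)%VS = fullv.
  by have := memvf (1 : L); rewrite -W1 -memv_preim lfunE /= mulr1.
apply: e_gen => a' i b'; rewrite -memv_preim lfunE /= !mulrA; apply: (J2R JR).
set y := e j * b * x * a' * e i.
have Jy d : d \in J -> d * y = 0.
  by move=> dJ; rewrite /y !mulrA Jx ?mul0r //; do 2! apply: JR.
have ey : e j * y = y by rewrite /y !mulrA ee.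
have ye : y * e i = y by rewrite /y -!mulrA ee.
have [ij|ij] := eqVneq i j; last by rewrite (socle_offdiag Jy ij ey ye) mem0v.
rewrite -{j}ij in y Jy ey ye *.
have [z zJ nuz] := socle_generator i; have /cornerP[||zJ2 ez ze] := zJ; [exact: J2L|exact: J2R|].
suff -> : y = (nu y / nu z) *: z by rewrite rpredZ.
apply/eqP; rewrite -subr_eq0; apply/eqP.
apply: (@socle_diag i) => [d dJ|||].
- by rewrite mulrBr -scalerAr Jy // J2_socle // scaler0 subrr.
- by rewrite mulrBr -scalerAr ey ez.
- by rewrite mulrBl -scalerAl ye ze.
- by rewrite linearB linearZ /= divfK // subrr.
Qed.

Lemma dim_corner_J2 i j : \dim (corner J2 i j) = (i == j).
Proof.
have [<-|ij] := eqVneq i j; last first.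
  apply/eqP; rewrite dimv_eq0 -subv0; apply/subvP => x.
  move=> /cornerP[]; [exact: J2L|exact: J2R|] => xJ ex xe.
  by rewrite (socle_offdiag (fun a aJ => J2_socle aJ xJ) ij ex xe) mem0v.
have [z zJ nuz] := socle_generator i.
have z0 : z != 0 by apply: contraNneq nuz => ->; rewrite linear0.
suff -> : corner J2 i i = <[z]>%VS by rewrite dim_vline z0.
apply/vspaceP => x; apply/idP/idP => [xJ|/vlineP[c ->]]; last exact: rpredZ.
by apply/vlineP; apply: socle_line xJ.
Qed.

Lemma dim_corner_full i j :
  \dim (corner fullv i j) = (\dim (corner J i j) + (i == j))%N.
Proof.
have fullP x k l : reflect (e l * x = x /\ x * e k = x) (x \in corner fullv k l).
  apply: (iffP (cornerP _ _ _ (@fullL _ _) (@fullR _ _))) => [[]|[]] //.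
  by move=> ? ?; split=> //; apply: memvf.
have [<-|ij] := eqVneq i j; last first.
  rewrite addn0; congr (\dim _); apply/vspaceP => x.
  apply/fullP/cornerP => // [[ex xe]|[]] //; split=> //.
  by rewrite -xe -ex; apply: e_orth.
have ei0 : e i != 0 by apply: contraNneq (e_notin i) => ->; rewrite mem0v.
suff -> : corner fullv i i = (corner J i i + <[e i]>)%VS.
  rewrite dimv_disjoint_sum ?dim_vline ?ei0 //; apply/eqP; rewrite -subv0.
  apply/subvP => x; rewrite memv_cap memv0 => /andP[/cornerP[//|//|xJ _ _]].
  case/vlineP=> c xE; rewrite xE in xJ *; have [->|c0] := eqVneq c 0.
    by rewrite scale0r.
  case/negP: (e_notin i); rewrite -[e i]scale1r -(mulVf c0) -scalerA.
  exact: rpredZ.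
apply/vspaceP => x; apply/fullP/memv_addP => [[ex xe]|[y /cornerP[//|//|_ ey ye]]].
  have [c cJ] := e_local i x; exists (x - c *: e i).
    apply/cornerP => //; split; last by rewrite mulrBl xe -scalerAl ee.
      by move: cJ; rewrite ex xe.
    by rewrite mulrBr ex -scalerAr ee.
  by exists (c *: e i); [apply/vlineP; exists c|rewrite subrK].
case=> _ /vlineP[c ->] ->.
by rewrite mulrDl mulrDr ey ye -scalerAl -scalerAr ee.
Qed.

Lemma dim_isotyp_projsp (X : {vspace L}) (I : finType) (j : I -> 'I_n) i :
  \dim (isotyp (e i) (projsp e X j)) = (\sum_l \dim (corner X (j l) i))%N.
Proof. by rewrite isotyp_prodsp dim_prodsp. Qed.

Notation state := (state J e).

Lemma radical_layer (s : state) : stably_scalar s ->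
  (projsp e J2 (@st_j _ _ _ _ _ s) <= st_U s)%VS ->
  st_U s <> projsp e J2 (@st_j _ _ _ _ _ s) ->
  idmul J (st_U s) = projsp e J2 (@st_j _ _ _ _ _ s).
Proof.
move=> scal subU neU; set Z := projsp _ _ _ in subU neU *; set U := st_U s in subU neU *.
have ZP (x : {ffun st_ix s -> L}) : reflect (forall l, x l \in J2 /\ x l * e (st_j l) = x l) (x \in Z).
  by apply: (projspP ee); apply: J2R.
have stU : stable U by apply: st_stable.
have UJ (x : {ffun st_ix s -> L}) : x \in U -> forall l, x l \in J /\ x l * e (st_j l) = x l.
  by move=> /(subvP (st_sub s))/(projspP ee _ _ JR).
have stJU := idmul_stable (U := U) JL.
have JUZ : (idmul J U <= Z)%VS.
  apply: idmul_sub => a x aJ xU; apply/ZP => l; rewrite ffunE.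
  by have [xJ xe] := UJ x xU l; rewrite -mulrA xe memv_mul.
(* Otherwise U would lie in the socle of Q, which is J^2 Q, and equal it. *)
have JU0 : idmul J U <> 0%VS.
  move=> JU0; apply: neU; apply/eqP; rewrite eqEsubv subU andbT.
  apply/subvP => x xU; apply/ZP => l; split; last by have [] := UJ x xU l.
  apply: socle_sub => a aJ; have := mem_idmul aJ xU.
  by rewrite JU0 memv0 => /eqP/ffunP/(_ l); rewrite !ffunE.
apply/eqP; rewrite eqEsubv JUZ /=; apply: contrapT => /negP ZJU.
have [i [z zZ [zJU ez]]] : exists i, exists2 z, z \in Z & z \notin idmul J U /\ lact (e i) z = z.
  apply: contrapT => noz; case/negP: ZJU.
  apply: (stable_generated e_gen) => //; first exact: (projsp_stable ee (J2L JL) (J2R JR)).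
  move=> i x xZ; apply: contrapT => /negP exn; apply: noz.
  exists i, (lact (e i) x); first exact: (projsp_stable ee (J2L JL) (J2R JR)).
  by split=> //; rewrite lactA ee.
have [f f0 fz] : exists2 f : {scalar {ffun st_ix s -> L}},
    forall x, x \in idmul J U -> f x = 0 & f z != 0.
  pose p := (\1 - projv (idmul J U))%VF.
  have pE x : p x = x - projv (idmul J U) x.
    by rewrite add_lfunE opp_lfunE id_lfunE.
  have [l pz] : exists l, p z l <> 0.
    apply: contrapT => nol; case/negP: zJU; have p0 : p z = 0.
      by apply/ffunP => l; rewrite [RHS]ffunE; apply: contrapT => ?; apply: nol; exists l.
    by move/eqP: p0; rewrite pE subr_eq0 => /eqP->; apply: memv_proj.
  have [a pza] : exists a, nu (a * p z l) <> 0.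
    by apply: contrapT => noa; apply: pz; apply: nu_nondeg => a;
       apply: contrapT => ?; apply: noa; exists a.
  have lf : linear_for *%R (fun x => nu (a * p x l)).
    by move=> c x y; rewrite linearP !ffunE mulrDr -scalerAr linearP.
  pose f : {scalar {ffun st_ix s -> L}} :=
    HB.pack (fun x => nu (a * p x l)) (GRing.isLinear.Build K _ K *%R _ lf).
  exists f.
    by move=> x xU /=; rewrite pE projv_id // subrr ffunE mulr0 linear0.
  by apply/eqP.
have [b bE] := functional_rep_ffun nu_nondeg f.
(* The functional f as an L-linear map to L; on U it kills J U and takes values in the socle. *)
pose psi (x : {ffun st_ix s -> L}) := \sum_l x l * b l.
have psiA a x : psi (lact a x) = a * psi x.
  by rewrite /psi mulr_sumr; apply: eq_bigr => l _; rewrite ffunE mulrA.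
have psiJ a x : a \in J -> x \in U -> a * psi x = 0.
  move=> aJ xU; apply: nu_nondeg => d; rewrite mulrA -psiA -bE f0 //.
  by apply: mem_idmul => //; apply: JL.
pose w := psi z; have ew : e i * w = w by rewrite /w -psiA ez.
pose sg := w * e i.
have nusg : nu sg != 0 by rewrite /sg nuC ew /w -bE.
have sg0 : sg != 0 by apply: contraNneq nusg => ->; rewrite linear0.
have sgC : sg \in corner J2 i i.
  apply/cornerP; [exact: J2L|exact: J2R|split].
  - apply: (J2R JR); apply: socle_sub => a aJ; apply: psiJ => //; exact: (subvP subU).
  - by rewrite /sg mulrA ew.
  - by rewrite /sg -mulrA ee.
(* The coordinates of z lie in e_i J^2 e_{j l}, which is the line through [sg] or zero. Hence z = sg
   y, and the matrix B below sends z to itself. *)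
have /choice[y yP] : forall l, exists y, y * e (st_j l) = y /\ z l = sg * y.
  move=> l; have /ZP/(_ l)[zlJ zle] := zZ.
  have ezl : e i * z l = z l by rewrite -{2}ez ffunE.
  have [ji|ji] := eqVneq (st_j l) i.
    have zC : z l \in corner J2 i i.
      by apply/cornerP; [exact: J2L|exact: J2R|split=> //; rewrite -{2}zle ji].
    have [c ->] := socle_line sgC sg0 zC; exists (c *: e i).
    by rewrite ji -scalerAl ee -scalerAr /sg -mulrA ee.
  exists 0; rewrite mul0r mulr0; split=> //.
  by apply: (socle_offdiag _ ji ezl zle) => a aJ; apply: J2_socle.
pose B l : {ffun st_ix s -> L} := [ffun m => b l * e i * y m].
have BE x m : mulB x B m = psi x * e i * y m.
  rewrite sum_ffunE /psi !mulr_suml; apply: eq_bigr => l _.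
  by rewrite !ffunE !mulrA.
have BZ x : x \in U -> mulB x B \in Z.
  move=> xU; apply/ZP => m; rewrite BE; split; last by have [ye _] := yP m; rewrite -mulrA ye.
  do 2! apply: (J2R JR); apply: socle_sub => a aJ; exact: psiJ.
have [x xU|c [B' [B'U B'E]]] := scal B; first by apply: (subvP subU); apply: BZ.
(* B' maps Q into U, inside J Q, hence J^2 Q into J^3 Q = 0. *)
have B'Z x : x \in Z -> mulB x B' = 0.
  move=> /ZP xZ; rewrite /mulB big1 // => l _; have [xJ xe] := xZ l.
  rewrite -xe -lactA -mulB_delta; have /UJ dU := B'U _ (delta_mem ee _ l).
  by apply/ffunP => m; rewrite !ffunE (J2J J3) //; have [] := dU m.
have cE x : x \in Z -> mulB x B = c *: x.
  by move=> xZ; rewrite B'E ?B'Z ?addr0 //; apply: (subvP subU).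
have BJU x : x \in idmul J U -> mulB x B = 0.
  move=> xJU; apply/eqP; rewrite -[mulB x B](lfunE (mulBl B)) -memv_ker.
  apply: (subvP (idmul_sub _)) xJU => a x' aJ x'U; rewrite memv_ker lfunE /=.
  by apply/eqP/ffunP => m; rewrite BE psiA psiJ // !mul0r ffunE.
(* On the nonzero subspace J U of J^2 Q the map B is both 0 and c. *)
have c0 : c = 0.
  have := memv_pick (idmul J U); set x := vpick _ => xJU.
  have x0 : x != 0 by rewrite vpick0; apply/eqP.
  have := cE x (subvP JUZ _ xJU); rewrite BJU // => /esym/eqP.
  by rewrite scaler_eq0 (negPf x0) orbF => /eqP.
case/negP: zJU; suff -> : z = 0 by apply: mem0v.
apply/ffunP => m; have [_ ->] := yP m; rewrite -/w -/sg.
have := cE z zZ; rewrite c0 scale0r => /ffunP/(_ m); rewrite BE.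
by rewrite /sg /w.
Qed.

End Socle.

(** * Dimension vectors of syzygies *)

Section DimensionVectors.

Variables (K : fieldType) (L : falgType K) (J : {vspace L}).
Hypotheses (JL : left_ideal J) (JR : right_ideal J).
Hypothesis J3 : forall a b c, a \in J -> b \in J -> c \in J -> a * b * c = 0.
Variables (n : nat) (e : 'I_n -> L).
Hypotheses (ee : forall i, e i * e i = e i).
Hypothesis e_local : forall i x, exists c, e i * x * e i - c *: e i \in J.
Hypothesis e_orth : forall i j x, i != j -> e j * x * e i \in J.
Hypothesis e_gen : forall W : {vspace L},
  (forall a i b, a * e i * b \in W) -> W = fullv.
Hypothesis e_notin : forall i, e i \notin J.
Variable nu : {scalar L}.
Hypothesis nuC : forall a b, nu (a * b) = nu (b * a).
Hypothesis nu_nondeg : forall x, (forall a, nu (a * x) = 0) -> x = 0.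
Variables (S : 'I_n -> lmodType L) (s : forall i, S i).
Hypothesis s_neq0 : forall i, s i <> 0.
Hypothesis s_gen : forall i (x : S i), exists a : L, a *: s i = x.
Hypothesis s_ann : forall i (a : L), a *: s i = 0 <-> a * e i \in J.
Hypothesis s_eigen : forall i (x : S i), e i *: x = x -> exists c : K, x = c%:A *: s i.
Hypothesis s_orth : forall i j (x : S j), i != j -> e i *: x = 0.
Hypothesis s_rad : forall (T : lmodType L) (a : L) (x : T), simple_module T ->
  a \in J -> a *: x = 0.
Hypothesis simS : forall i, simple_module (S i).

Notation J2 := (J * J)%VS.
Notation state := (state J e).
Notation next := (next JL JR J3 ee e_local e_orth e_gen).
Notation start := (start JL JR ee).
Notation stage := (stage JL JR J3 ee e_local e_orth e_gen).
Notation covP s := (covP JL JR J3 ee e_local e_orth e_gen s).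
Notation cov_u := (@cov_u _ _ _ JL JR J3 _ _ ee e_local e_orth e_gen _).
Notation cov_j := (@cov_j _ _ _ JL JR J3 _ _ ee e_local e_orth e_gen _).
Notation next_UP := (@next_UP _ _ _ JL JR J3 _ _ ee e_local e_orth e_gen _).
Notation resolution i := (simple_resolution JL JR J3 ee e_local e_orth e_gen
  (s_gen (i := i)) (s_ann i)).
Notation stj s := (@st_j _ _ _ _ _ s).

Lemma idmul_projsp (I : finType) (j : I -> 'I_n) :
  idmul J (projsp e J j) = projsp e J2 j.
Proof.
apply/eqP; rewrite eqEsubv; apply/andP; split.
  apply: idmul_sub => a x aJ /(projspP ee _ _ JR) xP.
  apply/(projspP ee _ _ (J2R JR)) => l; rewrite ffunE; have [xJ xe] := xP l.
  by split; [exact: memv_mul|rewrite -mulrA xe].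
apply/subvP => x /(projspP ee _ _ (J2R JR)) xP; rewrite (sum_delta x).
apply: rpred_sum => l _; have [xJ xe] := xP l; rewrite -xe.
pose f := (linfun (delta l) \o amulr (e (j l)))%VF.
have fE a : f a = delta l (a * e (j l)) by rewrite comp_lfunE !lfunE.
rewrite -fE memv_preim; apply: (subvP (_ : J2 <= _)%VS) xJ.
apply/prodvP => a b aJ bJ; rewrite -memv_preim fE -mulrA -lact_delta.
apply: mem_idmul => //; apply/(projspP ee _ _ JR) => m; rewrite ffunE.
case: eqP => [->|_]; last by rewrite mem0v mul0r.
by split; [exact: JR|rewrite -mulrA ee].
Qed.

Definition mult (I : finType) (j : I -> 'I_n) (m : 'I_n) : nat :=
  (\sum_l (j l == m))%N.

Lemma sum_mult (I : finType) (j : I -> 'I_n) (F : 'I_n -> nat) :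
  (\sum_l F (j l) = \sum_m mult j m * F m)%N.
Proof.
under [RHS]eq_bigr do rewrite big_distrl /=.
rewrite exchange_big; apply: eq_bigr => l _.
rewrite (bigD1 (j l)) //= eqxx mul1n big1 ?addn0 // => m ml.
by rewrite eq_sym (negPf ml).
Qed.

(** * Ext^1 between simple modules from the first cover *)

Section Ext.

Variable i : 'I_n.
Let C := resolution i.

Lemma hom_kills_radical (I : finType) (j : I -> 'I_n) (T : lmodType L)
    (f : {linear projmod ee j -> T}) x : simple_module T ->
  projval x \in projsp e J j -> f x = 0.
Proof.
move=> simT /(projspP ee _ _ JR) xP; rewrite (projmod_sum x) linear_sum big1 // => l _.
by rewrite linearZ /= s_rad //; have [] := xP l.
Qed.

Lemma idem_projgen (I : finType) (j : I -> 'I_n) l :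
  e (j l) *: projgen ee j l = projgen ee j l.
Proof.
apply: projval_inj; rewrite projvalZ -[projval _]/(delta l (e (j l))).
by rewrite lact_delta ee.
Qed.

Lemma scalar_eq0 j (c : K) : c%:A *: s j = 0 -> c = 0.
Proof.
move=> cs; apply: contrapT => /eqP c0; apply: (s_neq0 (i := j)).
rewrite -[s j]scale1r -[1]scale1r -(mulVf c0) -scalerA -[c *: 1]mul1r scalerAl.
by rewrite -scalerA cs scaler0.
Qed.

Lemma idem_s j : e j *: s j = s j.
Proof.
apply/eqP; rewrite -subr_eq0 -{2}[s j]scale1r -scalerBl; apply/eqP/s_ann.
by rewrite mulrBl ee mul1r subrr mem0v.
Qed.

(** Maps to a simple module kill the radical, so in a minimal resolution all coboundaries vanish and
    every map is a cocycle. Thus Ext^1 is Hom(P_1, S_j), with one dimension for each generator of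
    P_1 of index j. *)
Lemma ext1_mult j m : ext1_dim (S i) (S j) m ->
  m = mult (stj (next (start i))) j.
Proof.
move=> /(_ C)[f [_ fP]]; pose J1 := stj (next (start i)).
pose I1 := [set l | J1 l == j].
have multE : mult J1 j = #|I1|.
  rewrite /mult -sum1_card [RHS]big_mkcond /=; apply: eq_bigr => l _.
  by rewrite inE; case: eqP.
rewrite multE.
have J1l (p : 'I_#|I1|) : J1 (enum_val p) = j.
  by have := enum_valP p; rewrite inE => /eqP.
have ev (g : {linear projmod ee J1 -> S j}) (p : 'I_#|I1|) :
    exists c : K, g (projgen ee J1 (enum_val p)) = c%:A *: s j.
  have ej : e j = e (J1 (enum_val p)) by rewrite J1l.
  by apply: s_eigen; rewrite ej -linearZ idem_projgen.
have /choice[M0 M0P] : forall kp : 'I_m * 'I_#|I1|, exists c : K,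
    f kp.1 (projgen ee J1 (enum_val kp.2)) = c%:A *: s j.
  by move=> [k p]; apply: ev.
(* Values of the m given cocycles on the generators of index j. Uniqueness of coefficients makes the
   rows independent and existence makes M of full column rank, so M is square. *)
pose M : 'M[K]_(m, #|I1|) := \matrix_(k, p) M0 (k, p).
have offI (g : {linear projmod ee J1 -> S j}) l : l \notin I1 ->
    g (projgen ee J1 l) = 0.
  by rewrite inE => jl; rewrite -idem_projgen linearZ /= s_orth.
have agree (g h : {linear projmod ee J1 -> S j}) :
    (forall p : 'I_#|I1|, g (projgen ee J1 (enum_val p)) = h (projgen ee J1 (enum_val p))) ->
    g =1 h.
  move=> gh x; rewrite (projmod_sum x) !linear_sum; apply: eq_bigr => l _.
  rewrite !linearZ /=; congr (_ *: _); have [lI|lI] := boolP (l \in I1).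
    by rewrite -(enum_rankK_in lI lI) gh.
  by rewrite !offI.
pose fc (c : 'rV[K]_m) (x : projmod ee J1) : S j := \sum_k (c 0 k)%:A *: f k x.
have lfc c : linear (fc c).
  move=> a x y; rewrite /fc scaler_sumr -big_split; apply: eq_bigr => k _ /=.
  by rewrite linearP scalerDr !scalerA !mulr_algl mulr_algr.
have fcE c (p : 'I_#|I1|) : fc c (projgen ee J1 (enum_val p)) = ((c *m M) 0 p)%:A *: s j.
  rewrite mxE scaler_suml scaler_suml; apply: eq_bigr => k _.
  by rewrite (M0P (k, p)) scalerA mxE -scalerAl mul1r scalerA.
have cobound (g : {linear stmod ee (start i) -> S j}) x :
    g (next_diff JL JR J3 ee e_local e_orth e_gen (start i) x) = 0.
  apply: hom_kills_radical => //.
  by rewrite next_diffE; apply: (@next_diff_mem _ _ _ JL JR J3 _ _ ee e_local e_orth e_gen (start i)).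
have cocycle (g : {linear projmod ee J1 -> S j}) x :
    g (next_diff JL JR J3 ee e_local e_orth e_gen (next (start i)) x) = 0.
  apply: hom_kills_radical => //; rewrite next_diffE.
  apply: (subvP (next_sub JL JR J3 ee e_local e_orth e_gen _)).
  exact: (@next_diff_mem _ _ _ JL JR J3 _ _ ee e_local e_orth e_gen (next (start i))).
have repr (g : {linear projmod ee J1 -> S j}) : exists! c, g =1 fc c.
  have [|c [[h hP] cuniq]] := fP g; first by move=> x; apply: cocycle.
  exists c; split=> [x|c' gc'].
    by apply/eqP; rewrite -subr_eq0; apply/eqP; rewrite [LHS]hP cobound.
  apply: cuniq; exists h => x; rewrite [RHS]cobound -/(fc c' x) gc' subrr //.
have Mfree : row_free M.
  apply/inj_row_free => c cM0.
  have l0 : linear (fun _ : projmod ee J1 => 0 : S j).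
    by move=> a x y; rewrite scaler0 addr0.
  have [d [_ duniq]] := repr (linear_of l0).
  transitivity d; last first.
    apply: duniq => x; rewrite /= /fc big1 // => k _.
    by rewrite mxE scale0r scale0r.
  apply/esym/duniq => x; apply: (agree (linear_of l0) (linear_of (lfc c))) => p.
  by rewrite /= fcE cM0 mxE scale0r scale0r.
have Mfull : row_full M.
  apply/row_fullP; rewrite /=.
  have sol (v : 'rV[K]_#|I1|) : exists c, c *m M = v.
    pose g (x : projmod ee J1) : S j :=
      \sum_(p < #|I1|) projval x (enum_val p) *: ((v 0 p)%:A *: s j).
    have lg : linear g.
      move=> a x y; rewrite /g scaler_sumr -big_split; apply: eq_bigr => p _.
      by rewrite projvalD projvalZ !ffunE scalerDl -scalerA.
    have [c [gc _]] := repr (linear_of lg); exists c; apply/rowP => p.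
    apply/eqP; rewrite -subr_eq0; apply/eqP; apply: (@scalar_eq0 j).
    have genE q : projval (projgen ee J1 (enum_val p)) (enum_val q) =
        if q == p then e j else 0.
      rewrite -[projval _]/(delta (enum_val p) (e (J1 (enum_val p)))) ffunE J1l.
      by rewrite (inj_eq enum_val_inj).
    rewrite scalerBl scalerBl -fcE -gc -[linear_of lg _]/(g _) /g (bigD1 p) //.
    rewrite genE eqxx big1 => [|q /negPf qp]; last by rewrite genE qp scale0r.
    by rewrite /= addr0 scalerA mulr_algr -[v 0 p *: e j]mulr_algl -scalerA idem_s subrr.
  have /choice[B BP] := fun q => sol (delta_mx 0 q).
  exists (\matrix_q B q); apply/row_matrixP => q; rewrite row_mul rowK BP rowE.
  by rewrite mulmx1.
by apply/eqP; rewrite eqn_leq -(eqP Mfree) rank_leq_col (eqP Mfree) -(eqP Mfull) rank_leq_row.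
Qed.

End Ext.

Variable A : 'M[nat]_n.
Hypothesis extA : forall i j, ext1_dim (S i) (S j) (A i j).
Hypothesis nbrA : forall i, exists2 j, i != j & A i j != 0%N.

Lemma dim_isotyp_start (X : {vspace L}) i m :
  \dim (isotyp (e m) (projsp e X (fun _ : unit => i))) = \dim (corner e X i m).
Proof. by rewrite dim_isotyp_projsp (big_pred1 tt) // => -[]. Qed.

(** The radical of J e_i is J^2 e_i, and its top is counted by Ext^1. *)
Lemma dim_corner_J i m :
  \dim (corner e J i m) = (A i m + \dim (corner e J2 i m))%N.
Proof.
have := cover_count (covP (start i)) m.
rewrite [st_U _]/(projsp e J (fun _ : unit => i)) idmul_projsp !dim_isotyp_start => <-.
by congr (_ + _)%N; rewrite (ext1_mult (@extA i m)).
Qed.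

Lemma neighbour i : exists2 j, i != j & corner e J i j != 0%VS.
Proof.
have [j ij Aij] := nbrA i; exists j => //.
by rewrite -dimv_eq0 dim_corner_J addn_eq0 (negPf Aij).
Qed.

Let cJ2 := dim_corner_J2 JL JR J3 ee e_local e_orth nuC nu_nondeg neighbour.

Lemma dim_corner_fullA i m :
  \dim (corner e fullv i m) = (A i m + (i == m) + (i == m))%N.
Proof. by rewrite (dim_corner_full JL JR ee) // dim_corner_J cJ2. Qed.

Lemma dim_projsp_full (I : finType) (j : I -> 'I_n) m :
  \dim (isotyp (e m) (projsp e fullv j)) =
  (\sum_p mult j p * A p m + mult j m + mult j m)%N.
Proof.
rewrite dim_isotyp_projsp (sum_mult j (fun p => \dim (corner e fullv p m))).
have mE : (\sum_p mult j p * (p == m) = mult j m)%N.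
  rewrite (bigD1 m) //= eqxx muln1 big1 ?addn0 // => p /negPf->.
  by rewrite muln0.
rewrite -mE -!big_split; apply: eq_bigr => p _ /=.
by rewrite dim_corner_fullA !mulnDr.
Qed.

Lemma dim_projsp_J2 (I : finType) (j : I -> 'I_n) m :
  \dim (isotyp (e m) (projsp e J2 j)) = mult j m.
Proof. by rewrite dim_isotyp_projsp; apply: eq_bigr => l _; rewrite cJ2. Qed.

(* W k m is the multiplicity of S m in the top of the k-th syzygy of S i. *)
Record syzygy_chain (h : nat) (i i' : 'I_n) (W : nat -> 'I_n -> nat) : Prop :=
  SyzygyChain {
  chain_gt0 : (0 < h)%N;
  chain0 : forall m, W 0%N m = (i == m);
  chain1 : forall m, W 1%N m = A i m;
  chainS : forall k m, (k.+1 < h)%N ->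
    (W k.+2 m + W k m = \sum_p W k.+1 p * A p m)%N;
  chain_neq0 : forall k, (k < h)%N -> exists m, W k m <> 0%N;
  chain_last : forall m, W h.-1 m = (i' == m);
  chain_end : forall m, W h m = 0%N }.

(** * From a chain of multiplicity vectors to syzygies *)

Section Chain.

Variables (h : nat) (i i' : 'I_n) (W : nat -> 'I_n -> nat).
Hypothesis chW : syzygy_chain h i i' W.

(** The socle J^2 Q contributes W k to the dimension vector of U. The remaining W k.+1 is the top of
    U once J U = J^2 Q is known. *)
Definition stage_inv k (st : state) : Prop :=
  [/\ stably_scalar st, (projsp e J2 (stj st) <= st_U st)%VS,
     forall m, mult (stj st) m = W k m
   & forall m, \dim (isotyp (e m) (st_U st)) = (W k m + W k.+1 m)%N].

Lemma stage_radical k st : stage_inv k st -> (exists m, W k.+1 m <> 0%N) ->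
  idmul J (st_U st) = projsp e J2 (stj st).
Proof.
move=> [scal subU multE dimE] [m Wm].
apply: (radical_layer JL JR J3 ee e_local e_orth e_gen nuC nu_nondeg neighbour scal subU).
move=> UE; apply: Wm; apply/eqP; rewrite -(eqn_add2l (W k m)) -dimE UE.
by rewrite dim_projsp_J2 multE addn0.
Qed.

Lemma stage_inv_start : stage_inv 0 (start i).
Proof.
split.
- exact: stably_scalar_start.
- exact: (projspS ee _ (J2R JR) JR (J2_sub JL)).
- move=> m; rewrite (chain0 chW) /mult (big_pred1 tt) //; by case.
- move=> m; rewrite [st_U _]/(projsp e J (fun _ : unit => i)) dim_isotyp_start.
  by rewrite dim_corner_J cJ2 (chain0 chW) (chain1 chW) addnC.
Qed.

Lemma next_socle st : (projsp e J2 (stj (next st)) <= st_U (next st))%VS.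
Proof.
apply/subvP => x xJ2; have /(projspP ee _ _ (J2R JR)) xP := xJ2.
apply/next_UP; split.
  exact: (subvP (projspS ee _ (J2R JR) (@fullR _ _) (subvf _))).
rewrite /mulB big1 // => l _; have [xJ _] := xP l.
have /(subvP (st_sub st))/(projspP ee _ _ JR) uP := cover_in (covP st) l.
by apply/ffunP => m; rewrite !ffunE (J2J J3) //; have [] := uP m.
Qed.

Lemma dim_next st m : (\dim (isotyp (e m) (st_U (next st))) +
  \dim (isotyp (e m) (st_U st)) =
  \dim (isotyp (e m) (projsp e fullv (stj (next st)))))%N.
Proof.
have cov := covP st; set Q := projsp _ _ _.
have stQ : stable Q by apply: (projsp_stable ee (@fullL _ _) (@fullR _ _)).
rewrite -(limg_ker_dim (linfun (mulBl cov_u)) (isotyp (e m) Q)).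
apply: (f_equal2 addn); apply: (f_equal (@dimv _ _)); apply/vspaceP => x.
  rewrite memv_cap memv_ker lfunE /=.
  apply/(isotypP _ (ee m) (@st_stable _ _ _ _ _ (next st)))/andP.
    move=> [/next_UP[xQ xu] ex]; split; last by apply/eqP.
    by apply/isotypP.
  move=> [/(isotypP _ (ee m) stQ)[xQ ex] /eqP xu]; split=> //.
  by apply/next_UP.
apply/(isotypP _ (ee m) (@st_stable _ _ _ _ _ st))/memv_imgP.
  move=> [xU ex]; have [y yQ yx] := cover_surj cov xU.
  exists (lact (e m) y); last by rewrite lfunE /= mulB_lact yx ex.
  by apply/memv_imgP; exists y; rewrite ?lfunE.
move=> [y /(isotypP _ (ee m) stQ)[yQ ey] ->]; rewrite lfunE /= -mulB_lact ey; split=> //.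
exact: (@next_diff_mem _ _ _ JL JR J3 _ _ ee e_local e_orth e_gen st).
Qed.

(** With t and t' the tops of Q and of the cover Q' of U, the kernel has dimension vector (A t' + 2
    t') - (t + t') = t' + (A t' - t). *)
Lemma stage_inv_next k st : (k.+1 < h)%N -> stage_inv k st ->
  stage_inv k.+1 (next st).
Proof.
move=> kh inv; have rad := stage_radical inv (chain_neq0 chW kh).
have [scal subU multE dimE] := inv.
have multE' m : mult (stj (next st)) m = W k.+1 m.
  have : (mult (stj (next st)) m + \dim (isotyp (e m) (idmul J (st_U st))) =
    \dim (isotyp (e m) (st_U st)))%N := cover_count (covP st) m.
  by rewrite rad dim_projsp_J2 multE dimE; lia.
split=> // [||m].
- exact: (stably_scalar_next nu_nondeg scal).
- exact: next_socle.
apply/eqP; rewrite -(eqn_add2r (\dim (isotyp (e m) (st_U st)))) dim_next.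
rewrite dim_projsp_full !multE' dimE.
under eq_bigr do rewrite multE'.
by rewrite -(chainS chW _ kh); lia.
Qed.

Lemma stage_invP k : (k < h)%N -> stage_inv k (stage i k).
Proof.
elim: k => [_|k IH kh]; first exact: stage_inv_start.
by apply: stage_inv_next => //; apply: IH; apply: ltnW.
Qed.

(** J would kill the syzygy U, but J U = J^2 Q has the nonzero dimension vector W (q-1). *)
Lemma chain_not_simple q (T : lmodType L) : (0 < q < h)%N -> simple_module T ->
  ~ syzygy q (S i) T.
Proof.
case: q => // q /andP[_ qh] simT.
move/(_ _ (simple_resolution_minimal JL JR J3 ee e_local e_orth e_gen
  (s_gen (i := i)) (s_ann i))) => [g [gsurj gP]].
have inv := stage_invP (ltnW qh).
have rad := stage_radical inv (chain_neq0 chW qh).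
have JU0 : idmul J (st_U (stage i q)) = 0%VS.
  apply/eqP; rewrite -subv0; apply: idmul_sub => a x aJ xU; rewrite memv0.
  have [y yQ <-] := cover_surj (covP (stage i q)) xU.
  have /gP[z zE] : g (a *: (projelt ee yQ)) = 0 by rewrite linearZ /= s_rad.
  have /next_UP[_] : projval (a *: projelt ee yQ) \in next_U JL JR J3 ee e_local e_orth e_gen (stage i q).
    apply/(@next_diff_image _ _ _ JL JR J3 _ _ ee e_local e_orth e_gen (stage i q.+1)).
    by exists z.
  by rewrite projvalZ mulB_lact => ->.
have [m []] := chain_neq0 chW (ltnW qh).
have [_ _ <- _] := inv; rewrite -dim_projsp_J2 -rad JU0 /isotyp limg0.
exact: dimv0.
Qed.

(** In stage h-1 the vanishing of W h leaves U = J^2 Q, which is semisimple with S_{i'} as its only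
    composition factor. This is read off from its cover: a single generator, of index i'. *)
Lemma chain_syzygy : syzygy h (S i) (S i').
Proof.
apply: (syzygyP (simple_resolution_minimal JL JR J3 ee e_local e_orth e_gen
  (s_gen (i := i)) (s_ann i))).
have hE : h = h.-1.+1 by rewrite prednK // (chain_gt0 chW).
have := @stage_invP h.-1; rewrite -hE leqnn => /(_ isT) inv.
have [scal subU multE dimE] := inv; set st := stage i h.-1 in inv scal subU multE dimE.
have stU := @st_stable _ _ _ _ _ st.
have UE : st_U st = projsp e J2 (stj st).
  apply/eqP; rewrite eqEsubv subU andbT; apply: (stable_generated e_gen) => //.
    exact: (projsp_stable ee (J2L JL) (J2R JR)).
  move=> m x xU; have : lact (e m) x \in isotyp (e m) (st_U st).
    by apply/memv_imgP; exists x; rewrite ?lfunE.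
  have -> : isotyp (e m) (st_U st) = isotyp (e m) (projsp e J2 (stj st)).
    apply/esym/eqP; rewrite eqEdim isotypS //=.
    by rewrite dimE dim_projsp_J2 multE -hE (chain_end chW) addn0.
  by case/(isotypP _ (ee m) (projsp_stable ee (J2L JL) (J2R JR))).
have JU0 : idmul J (st_U st) = 0%VS.
  apply/eqP; rewrite -subv0 UE; apply: idmul_sub => a x aJ.
  move=> /(projspP ee _ _ (J2R JR)) xP; rewrite memv0; apply/eqP/ffunP => l.
  by rewrite !ffunE (J2_socle J3) //; have [] := xP l.
have multE' m : mult (stj (next st)) m = (i' == m).
  have : (mult (stj (next st)) m + \dim (isotyp (e m) (idmul J (st_U st))) =
    \dim (isotyp (e m) (st_U st)))%N := cover_count (covP st) m.
  rewrite JU0 dimE -hE (chain_end chW) (chain_last chW) /isotyp limg0 dimv0; lia.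
have ji l : stj (next st) l = i'.
  apply/eqP; have := multE' (stj (next st) l); rewrite /mult (bigD1 l) //= eqxx eq_sym.
  by case: eqP.
have [l0 l0P] : exists l0, forall l : st_ix (next st), l = l0.
  have := multE' i'; rewrite /mult eqxx.
  under eq_bigr do rewrite ji eqxx.
  rewrite sum1_card => /eqP/fintype1P[l0 l0P]; exists l0 => l.
  by apply/eqP; rewrite l0P.
rewrite hE.
pose g (x : stmod ee (next st)) : S i' := projval x l0 *: s i'.
have lg : linear g.
  by move=> a x y; rewrite /g projvalD projvalZ !ffunE scalerDl scalerA.
exists (linear_of lg); split=> [y|x].
  have [a <-] := s_gen y; exists (a *: projgen ee (stj (next st)) l0).
  rewrite linearZ; congr (_ *: _).
  rewrite -[LHS]/(delta l0 (e (stj (next st) l0)) l0 *: s i') ffunE eqxx ji.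
  exact: idem_s.
rewrite (@next_diff_image _ _ _ JL JR J3 _ _ ee e_local e_orth e_gen (stage i h.-1.+1)).
rewrite -[linear_of lg x]/(g x) /g s_ann -(ji l0) projval_idem; split=> [xJ|xU].
  have xJQ : projval x \in projsp e J (stj (next st)).
    apply/(projspP ee _ _ JR) => l; rewrite (l0P l); split=> //; exact: projval_idem.
  apply/next_UP; split; first exact: projval_mem.
  apply/eqP; rewrite -memv0 -JU0; apply: rpred_sum => l _; apply: mem_idmul.
    by rewrite (l0P l).
  exact: (cover_in (covP st)).
have := subvP (next_sub JL JR J3 ee e_local e_orth e_gen st) _ xU.
by case/(projspP ee _ _ JR)/(_ l0).
Qed.

End Chain.

End DimensionVectors.

(** * Chebyshev recursions on the diagrams *)

Section Combinatorics.

Local Open Scope nat_scope.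

Section Paths.

Implicit Types (f : nat -> nat) (n m : nat).

Lemma sum_pick n f (a : nat) :
  \sum_(p < n) f p * (p == a :> nat) = if a < n then f a else 0.
Proof.
case: ltnP => an; last first.
  by rewrite big1 // => p _; case: eqP => [pa|_]; rewrite ?muln0 //; have := ltn_ord p; lia.
rewrite (bigD1 (Ordinal an)) //= eqxx muln1 big1 ?addn0 // => p pa.
by case: eqP => [pE|_]; rewrite ?muln0 //; case/eqP: pa; apply: val_inj.
Qed.

Lemma sum_path n f m : m < n ->
  \sum_(p < n) f p.+1 * ((m.+1 == p.+2) || (p.+1 == m.+2)) =
  (if m is m'.+1 then f m else 0) + (if m.+1 < n then f m.+2 else 0).
Proof.
move=> mn; rewrite -(sum_pick n (fun p => f p.+1) m.+1).
have -> : (if m is m'.+1 then f m else 0) =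
    \sum_(p < n) f p.+1 * (p.+1 == m :> nat).
  case: m mn => [|m] mn; first by rewrite big1 // => p _; rewrite muln0.
  under eq_bigr do rewrite eqSS.
  by have /= -> := sum_pick n (fun p => f p.+1) m; rewrite (ltnW mn).
rewrite -big_split; apply: eq_bigr => p _ /=.
by rewrite -mulnDr; congr (_ * _); do 4! case: eqP => //; lia.
Qed.

(* The coefficient at j of U_k(A) e_i, for the Chebyshev polynomial U_k and the
   path A on the vertices 1, ..., n. *)
Definition path_coef (n k i j : nat) : nat :=
  [&& ~~ odd (i + j + k), i <= j + k, j <= i + k, k.+2 <= i + j & i + j + k <= 2 * n].

Lemma path_coef0 n k i j : 0 < i -> j = 0 -> path_coef n k i j = 0.
Proof. by move=> i0 ->; rewrite /path_coef; case: and5P => // -[]; lia. Qed.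

Lemma path_coef_top n k i j : i <= n -> j = n.+1 -> path_coef n k i j = 0.
Proof. by move=> i0 ->; rewrite /path_coef; case: and5P => // -[]; lia. Qed.

Lemma path_coef_end n i j : path_coef n n i j = 0.
Proof. by rewrite /path_coef; case: and5P => // -[]; lia. Qed.

Lemma path_coef_start n i j : 0 < i <= n -> path_coef n 0 i j = (i == j).
Proof.
move=> i0; rewrite /path_coef addn0; case: and5P => [[_ ? ? _ _]|nE]; case: eqP => //; first lia.
by move=> ij; case: nE; rewrite -ij; split; lia.
Qed.

Lemma path_coef_last n i j : 0 < i <= n -> path_coef n n.-1 i j = (j == n.+1 - i).
Proof.
move=> i0; rewrite /path_coef; case: and5P => [[_ ? ? ? ?]|nE]; case: eqP => //; first lia.
by move=> ij; case: nE; rewrite ij; split; try lia.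
Qed.

(** The conditions in [path_coef] are the Clebsch-Gordan rule for SU(2) truncated at level n - 1,
    which satisfies the Chebyshev recursion. The phantom vertices 0 and n+1 have coefficient 0. *)
Lemma path_coefS n k i j : 0 < i <= n -> 0 < j <= n -> k.+1 < n ->
  path_coef n k.+2 i j + path_coef n k i j =
  path_coef n k.+1 i j.-1 + path_coef n k.+1 i j.+1.
Proof.
move=> i0 j0 kn; rewrite /path_coef.
have [q qE] : exists q, i + j + k = 2 * q + odd (i + j + k).
  by exists (i + j + k)./2; rewrite -[LHS]odd_double_half; lia.
have -> : odd (i + j + k.+2) = odd (i + j + k) by lia.
have -> : odd (i + j.-1 + k.+1) = odd (i + j + k) by lia.
have -> : odd (i + j.+1 + k.+1) = odd (i + j + k) by lia.
case: (odd _) qE => //= qE; lia.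
Qed.

Lemma path_coef1 n i j : 1 < n -> 0 < i <= n -> 0 < j <= n ->
  path_coef n 1 i j = ((j == i.+1) || (i == j.+1)).
Proof.
move=> n1 i0 j0; rewrite /path_coef; lia.
Qed.

Lemma path_coef_neq0 n k i : 0 < i <= n -> k < n ->
  exists2 j, 0 < j <= n & path_coef n k i j = 1.
Proof.
(* The least vertex of the support, |i - (k+1)| + 1. *)
move=> i0 kn; exists (maxn (i - k) (k.+2 - i)); first lia.
rewrite /path_coef; lia.
Qed.

Lemma path_coef_sym n k i j : i <= n.+1 -> j <= n.+1 ->
  path_coef n k (n.+1 - i) (n.+1 - j) = path_coef n k i j.
Proof.
move=> i0 j0; rewrite /path_coef.
have -> : odd (n.+1 - i + (n.+1 - j) + k) = odd (i + j + k) by lia.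
by case: (odd _) => //=; lia.
Qed.

End Paths.

Section Chains.

Variable n : nat.

Lemma chain_A (i : 'I_n) : 1 < n ->
  syzygy_chain (diagram_A n) n i (rev_ord i)
    (fun k m => path_coef n k i.+1 m.+1).
Proof.
move=> n1; have i0 : 0 < i.+1 <= n by rewrite ltn_ord.
have m0 (m : 'I_n) : 0 < m.+1 <= n by rewrite ltn_ord.
split=> [|m|m|k m kn|k kn|m|m].
- exact: ltnW.
- by rewrite path_coef_start // eqSS.
- by rewrite path_coef1 // mxE.
- rewrite path_coefS //.
  under [RHS]eq_bigr do rewrite mxE.
  have /= -> := sum_path (path_coef n k.+1 i.+1) (ltn_ord m).
  congr (_ + _).
    by case: (nat_of_ord m) => //=; rewrite path_coef0.
  case: ltnP => // mn; rewrite path_coef_top //.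
  by apply/eqP; rewrite eqSS eqn_leq mn andbT.
- have [j j0 jE] := path_coef_neq0 i0 kn.
  have jn : j.-1 < n by lia.
  by exists (Ordinal jn) => /=; rewrite prednK ?jE //; lia.
- by rewrite path_coef_last // -val_eqE /=; congr nat_of_bool; have := ltn_ord i; lia.
- exact: path_coef_end.
Qed.

(** The 0-based vertex m has the two lifts n+m+1 and n-m in A_{2n}, exchanged by the reflection; the
    edge between n and n+1 becomes the loop. The involution of A_{2n} only exchanges lifts, so it
    becomes trivial. *)
Lemma chain_L (i : 'I_n) : 1 < n ->
  syzygy_chain (diagram_L n) (2 * n) i i
    (fun k m => path_coef (2 * n) k (n + i.+1) (n + m.+1) +
                path_coef (2 * n) k (n + i.+1) (n - m)).
Proof.
move=> n1; have i0 : 0 < n + i.+1 <= 2 * n by have := ltn_ord i; lia.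
have m0 (m : 'I_n) : 0 < n + m.+1 <= 2 * n by have := ltn_ord m; lia.
have m1 (m : 'I_n) : 0 < n - m <= 2 * n by have := ltn_ord m; lia.
have n2 : 1 < 2 * n by lia.
split=> [|m|m|k m kn|k kn|m|m].
- lia.
- rewrite !path_coef_start // -val_eqE /=; have := ltn_ord m; lia.
- rewrite !path_coef1 // mxE /=; have := ltn_ord m; have := ltn_ord i; lia.
- rewrite addnACA !path_coefS //.
  (* The folded coefficient, extended to M = 0 and M = n+1: f 0 = f 1 accounts for the loop, and f
     (n+1) = 0. *)
  pose f M := path_coef (2 * n) k.+1 (n + i.+1) (n + M) +
    path_coef (2 * n) k.+1 (n + i.+1) (n.+1 - M).
  have -> : \sum_(p < n) (path_coef (2 * n) k.+1 (n + i.+1) (n + p.+1) +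
      path_coef (2 * n) k.+1 (n + i.+1) (n - p)) * diagram_L n p m =
      \sum_(p < n) f p.+1 * ((m.+1 == p.+2) || (p.+1 == m.+2)) +
      \sum_(p < n) (f p.+1 * (m == 0 :> nat)) * (p == 0 :> nat).
    rewrite -big_split; apply: eq_bigr => p _ /=; rewrite mxE /f subSS.
    rewrite -mulnA -mulnDr; congr (_ * _); lia.
  rewrite sum_path // (sum_pick n (fun p => f p.+1 * (m == 0 :> nat)) 0).
  have -> : 0 < n by lia.
  have fn : f n.+1 = 0 by rewrite /f path_coef_top ?path_coef0 //; lia.
  have -> : (if m.+1 < n then f m.+2 else 0) = f m.+2.
    by case: ltnP => // nm; rewrite (_ : m.+2 = n.+1) ?fn //; have := ltn_ord m; lia.
  have -> : (if nat_of_ord m is m'.+1 then f m else 0) + f m.+2 + f 1 * (m == 0 :> nat) =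
      f m + f m.+2.
    case: (nat_of_ord m) => [|m'] /=; last by rewrite muln0 addn0.
    have f01 : f 0 = f 1 by rewrite /f addn0 subn0 addn1 subSS subn0 addnC.
    by rewrite muln1 add0n f01 addnC.
  have mn := ltn_ord m; rewrite /f.
  have -> : (n + m.+1).-1 = n + m by lia.
  have -> : (n + m.+1).+1 = n + m.+2 by lia.
  have -> : (n - m).-1 = n.+1 - m.+2 by lia.
  have -> : (n - m).+1 = n.+1 - m by lia.
  lia.
- have [j j0 jE] := path_coef_neq0 i0 kn.
  have [jn|jn] := leqP j n.
    have jn' : n - j < n by lia.
    by exists (Ordinal jn') => /=; rewrite subKn // jE; lia.
  have jn' : j - n.+1 < n by lia.
  exists (Ordinal jn') => /=; rewrite (_ : n + (j - n.+1).+1 = j) ?jE //; lia.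
- rewrite !path_coef_last // -val_eqE /=; have := ltn_ord m; have := ltn_ord i; lia.
- by rewrite !path_coef_end.
Qed.

End Chains.

Definition swap12 n (i : 'I_n) : 'I_n :=
  insubd i (if i == 0 :> nat then 1 else if i == 1 :> nat then 0 else i : nat).

Lemma val_swap12 n (i : 'I_n) : 1 < n -> swap12 i =
  (if i == 0 :> nat then 1 else if i == 1 :> nat then 0 else i : nat) :> nat.
Proof.
move=> n1; rewrite val_insubd ifT //; have := ltn_ord i.
by do 2! case: ifP => // _; lia.
Qed.

Section ChainsD.

Variable n : nat.
Hypothesis n4 : 3 < n.

(* D_n is obtained from the path with 2n-3 vertices by identifying the vertices
   a and 2n-2-a and splitting the middle vertex n-1 into the vertices 1 and 2. *)
Definition coef_D (i k m : nat) : nat :=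
  if 2 < i then
    if 2 < m then path_coef (2 * n - 3) k (n.+1 - i) (n.+1 - m) +
                  path_coef (2 * n - 3) k (n + i - 3) (n.+1 - m)
    else path_coef (2 * n - 3) k (n.+1 - i) n.-1
  else
    if 2 < m then path_coef (2 * n - 3) k n.-1 (n.+1 - m)
    else (k < 2 * n - 3) && (k %% 4 == 2 * (m != i)).

Lemma sum_D (f : nat -> nat) (m : 'I_n) :
  \sum_(p < n) f p.+1 * diagram_D n p m =
  (if m < 2 then f 3 else if m == 2 :> nat then f 1 + f 2 + f 4
   else f m + (if m.+1 < n then f m.+2 else 0)).
Proof.
have mn := ltn_ord m.
transitivity (\sum_(p < n) (f p.+1 * (m == 2 :> nat)) * (p == 0 :> nat) +
    \sum_(p < n) (f p.+1 * (1 < m)) * (p == m.-1 :> nat) +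
    (\sum_(p < n) (f p.+1 * (m == 0 :> nat)) * (p == 2 :> nat) +
     \sum_(p < n) (f p.+1 * (0 < m)) * (p == m.+1 :> nat))).
  rewrite -!big_split; apply: eq_bigr => p _ /=; rewrite mxE.
  rewrite -!mulnA -!mulnDr; congr (_ * _).
  by case: (nat_of_ord m) (nat_of_ord p) => [|[|[|m']]] [|[|[|p']]] //=;
    rewrite ?eqSS ?mul1n ?mul0n ?add0n //; do 3? case: eqP => // ?; exfalso; lia.
have /= -> := sum_pick n (fun p => f p.+1 * (m == 2 :> nat)) 0.
have /= -> := sum_pick n (fun p => f p.+1 * (1 < m)) m.-1.
have /= -> := sum_pick n (fun p => f p.+1 * (m == 0 :> nat)) 2.
have /= -> := sum_pick n (fun p => f p.+1 * (0 < m)) m.+1.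
have -> : 0 < n by lia.
have -> : m.-1 < n by lia.
have -> : 2 < n by lia.
case: (nat_of_ord m) mn => [|[|[|m']]] mn /=;
  rewrite ?muln1 ?muln0 ?addn0 ?add0n //.
- by case: ifP; rewrite addn0.
- by rewrite ltnW.
- by rewrite n4.
Qed.

(** For even k, the residues of k and k+2 are 0 and 2 in some order. At a fork tip this is the
    recursion: starting from a tip, the coefficient alternates between the two tips. *)
Lemma mod4_alternate (k : nat) (b : bool) :
  (k.+2 %% 4 == 2 * b) + (k %% 4 == 2 * b) = ~~ odd k.
Proof.
rewrite -addn2 -modnDml [in odd k](divn_eq k 4) oddD oddM andbF.
by case: (k %% 4) (ltn_pmod k (isT : 0 < 4)) b => [|[|[|[|]]]] // _ [].
Qed.

Lemma path_coef_mid k : k < 2 * n - 3 ->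
  path_coef (2 * n - 3) k n.-1 n.-1 = ~~ odd k.
Proof.
move=> kN; rewrite /path_coef addnn oddD odd_double /= leq_addr.
have -> : k.+2 <= n.-1.*2 by lia.
have -> : n.-1.*2 + k <= 2 * (2 * n - 3) by lia.
by rewrite !andbT.
Qed.

Lemma path_coef_next_mid k : k.+1 < 2 * n - 3 ->
  path_coef (2 * n - 3) k.+1 n.-1 (n.+1 - 3) = ~~ odd k.
Proof.
move=> kN; rewrite /path_coef; have -> : n.-1 + (n.+1 - 3) + k.+1 = n.-1.*2 + k by lia.
rewrite oddD odd_double /=; have [//|ok] := boolP (odd k).
have kE : k = k./2.*2 by rewrite -[LHS]odd_double_half (negPf ok).
have -> : n.-1 <= n.+1 - 3 + k.+1 by lia.
have -> : n.+1 - 3 <= n.-1 + k.+1 by lia.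
have -> : k.+3 <= n.-1 + (n.+1 - 3) by lia.
by have -> : n.-1.*2 + k <= 2 * (2 * n - 3) by lia.
Qed.

Lemma coef_D0 (i m : nat) : 0 < i <= n -> 0 < m <= n -> coef_D i 0 m = (i == m).
Proof.
move=> i0 m0; rewrite /coef_D; have [i2|i2] := ltnP 2 i; have [m2|m2] := ltnP 2 m.
- rewrite !path_coef_start; [|lia|lia].
  by do 3! case: eqP => // ?; exfalso; lia.
- rewrite path_coef_start; last lia.
  by do 2! case: eqP => // ?; exfalso; lia.
- rewrite path_coef_start; last lia.
  by do 2! case: eqP => // ?; exfalso; lia.
- have -> : 0 < 2 * n - 3 by lia.
  by rewrite [i == m]eq_sym; case: (m == i).
Qed.

Lemma coef_D1 (i m : 'I_n) : coef_D i.+1 1 m.+1 = diagram_D n i m.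
Proof.
have ni := ltn_ord i; have nm := ltn_ord m; rewrite mxE /coef_D.
move: (nat_of_ord i) (nat_of_ord m) ni nm => {}i {}m ni nm.
have [i2|i2] := ltnP 2 i.+1; have [m2|m2] := ltnP 2 m.+1.
- rewrite !path_coef1; [|lia..].
  have -> : (i.+1 == 1) = false by lia.
  have -> : (m.+1 == 1) = false by lia.
  have -> : 1 < i.+1 by lia.
  have -> : 1 < m.+1 by lia.
  by rewrite /=; do 6? case: eqP => //= ?; exfalso; lia.
- rewrite path_coef1; [|lia..].
  by case: m nm m2 => [|[|m]] // nm m2; case: i ni i2 => [|[|[|i]]] //= ni i2;
    do 3? case: eqP => //= ?; exfalso; lia.
- rewrite path_coef1; [|lia..].
  by case: i ni i2 => [|[|i]] // ni i2; case: m nm m2 => [|[|[|m]]] //= nm m2;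
    do 3? case: eqP => //= ?; exfalso; lia.
- rewrite andbC; case: i ni i2 => [|[|i]] // ni i2; by case: m nm m2 => [|[|m]].
Qed.

Lemma coef_DS_chain (i : nat) (m : 'I_n) k : 2 < i <= n -> k.+1 < 2 * n - 3 ->
  coef_D i k.+2 m.+1 + coef_D i k m.+1 =
  \sum_(p < n) coef_D i k.+1 p.+1 * diagram_D n p m.
Proof.
move=> /andP[i2 ni] kn; rewrite (sum_D (coef_D i k.+1)); have nm := ltn_ord m.
set N := 2 * n - 3 in kn *.
have a0 : 0 < n.+1 - i <= N by lia.
have a1 : 0 < n + i - 3 <= N by lia.
have mid0 : 0 < n.-1 <= N by lia.
have b0 : 0 < n.+1 - m.+1 <= N by lia.
(* The lifts n+1-i and n+i-3 are mirror images, so every term can be expressed through the first. *)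
have sym b : b <= N.+1 -> path_coef N k.+1 (n + i - 3) b =
    path_coef N k.+1 (n.+1 - i) (N.+1 - b).
  by move=> bN; rewrite -path_coef_sym; [congr path_coef; lia|lia|lia].
rewrite /coef_D -/N i2; have [m2|m2] := ltnP 2 m.+1; last first.
  rewrite /= path_coefS // sym; last lia.
  by congr (_ + _); congr path_coef; lia.
rewrite addnACA !path_coefS //.
have [m3|m3] := eqVneq (nat_of_ord m) 2.
  rewrite m3 /= (sym (n.+1 - 3).+1); last lia.
  have -> : N.+1 - (n.+1 - 3).+1 = n.-1 by lia.
  have -> : (n.+1 - 3).+1 = n.-1 by lia.
  have -> : (n.+1 - 3).-1 = n.+1 - 4 by lia.
  lia.
have -> : 2 < m by lia.
have -> : (n.+1 - m.+1).+1 = n.+1 - m by lia.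
have -> : (n.+1 - m.+1).-1 = n.+1 - m.+2 by lia.
have -> : 2 < m.+2 by lia.
case: ltnP => mn; first lia.
have -> : n.+1 - m.+2 = 0 by lia.
by rewrite !(@path_coef0 N k.+1 _ 0) //; lia.
Qed.

Lemma coef_DS_fork (i : nat) (m : 'I_n) k : 0 < i <= 2 -> k.+1 < 2 * n - 3 ->
  coef_D i k.+2 m.+1 + coef_D i k m.+1 =
  \sum_(p < n) coef_D i k.+1 p.+1 * diagram_D n p m.
Proof.
move=> /andP[i0 i2] kn; rewrite (sum_D (coef_D i k.+1)); have nm := ltn_ord m.
have b0 : 0 < n.+1 - m.+1 <= 2 * n - 3 by lia.
have mid0 : 0 < n.-1 <= 2 * n - 3 by lia.
rewrite /coef_D [2 < i]ltnNge i2 [~~ true]/=; have [m2|m2] := ltnP 2 m.+1; last first.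
  rewrite [2 < 3]/= path_coef_next_mid //.
  have -> : k < 2 * n - 3 by lia.
  have [k2|k2] := ltnP k.+2 (2 * n - 3); first by rewrite mod4_alternate.
  (* Boundary case k+2 = 2n-3, where the guard in [coef_D] sets the tip coefficient to 0. This
     agrees with the recursion because k is odd. *)
  have kE : k = (n - 3).*2.+1 by lia.
  rewrite kE /= odd_double add0n.
  by case: eqP => // kM; exfalso; case: (_ != _) kM; lia.
rewrite path_coefS //; have [m3|m3] := eqVneq (nat_of_ord m) 2.
  rewrite m3.
  have -> : (n.+1 - 3).+1 = n.-1 by lia.
  have -> : (n.+1 - 3).-1 = n.+1 - 4 by lia.
  rewrite path_coef_mid // kn [2 < 1]/= [2 < 2]/= [2 < 4]/=.
  rewrite addnC; congr (_ + _).
  have -> : (2 != i) = ~~ (1 != i) by case: i i0 i2 => [|[|[|]]].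
  rewrite [in odd _](divn_eq k.+1 4) oddD oddM andbF.
  by case: (k.+1 %% 4) (ltn_pmod k.+1 (isT : 0 < 4)) (1 != i) => [|[|[|[|]]]] // _ [].
have -> : 2 < m by lia.
have -> : (n.+1 - m.+1).+1 = n.+1 - m by lia.
have -> : (n.+1 - m.+1).-1 = n.+1 - m.+2 by lia.
have -> : 2 < m.+2 by lia.
case: ltnP => mn; first by rewrite addnC.
have -> : n.+1 - m.+2 = 0 by lia.
by rewrite (@path_coef0 _ k.+1 _ 0) ?addn0 //; lia.
Qed.

(** A vertex in the support on the path is folded: the middle goes to a tip, the left half to n+1-j,
    and the right half is reflected first. *)
Lemma coef_D_neq0 (i : 'I_n) k : k < 2 * n - 3 ->
  exists m : 'I_n, coef_D i.+1 k m.+1 <> 0.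
Proof.
move=> kn; have ni := ltn_ord i; set N := 2 * n - 3 in kn.
have [i2|i2] := ltnP 2 i.+1.
  have a0 : 0 < n.+1 - i.+1 <= N by lia.
  have [j j0 jE] := path_coef_neq0 a0 kn.
  have [jm|jm] := eqVneq j n.-1.
    have m0 : 0 < n by lia.
    by exists (Ordinal m0); rewrite /coef_D i2 /= -jm jE.
  have [jn|jn] := ltnP j n.-1.
    have mn : n - j < n by lia.
    exists (Ordinal mn); rewrite /coef_D i2 /= ifT; last lia.
    by rewrite -/N (_ : n.+1 - (n - j).+1 = j) ?jE //; lia.
  have mn : j - (n - 2) < n by lia.
  exists (Ordinal mn); rewrite /coef_D i2 /= ifT; last lia.
  have : path_coef N k (n + i.+1 - 3) (n.+1 - (j - (n - 2)).+1) = 1.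
    by rewrite -jE -path_coef_sym; [congr path_coef; lia|lia|lia].
  by rewrite -/N => ->; rewrite addn1.
have mid0 : 0 < n.-1 <= N by lia.
have [j j0 jE] := path_coef_neq0 mid0 kn.
have [jm|jm] := eqVneq j n.-1.
  have kE : (k %% 4 == 0) || (k %% 4 == 2).
    move: jE; rewrite jm path_coef_mid // [in odd _](divn_eq k 4) oddD oddM andbF.
    by case: (k %% 4) (ltn_pmod k (isT : 0 < 4)) => [|[|[|[|]]]].
  have m0 : 1 - i < n by lia.
  case/orP: kE => /eqP kE; [exists i|exists (Ordinal m0)]; rewrite /coef_D kE.
    by rewrite -/N kn ltnNge i2 eqxx.
  by rewrite -/N kn [nat_of_ord (Ordinal _)]/=; case: (nat_of_ord i) i2 => [|[|]].
have [jn|jn] := ltnP j n.-1.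
  have mn : n - j < n by lia.
  exists (Ordinal mn); rewrite /coef_D ltnNge i2 /= ifT; last lia.
  by rewrite -/N (_ : n.+1 - (n - j).+1 = j) ?jE //; lia.
have mn : j - (n - 2) < n by lia.
exists (Ordinal mn); rewrite /coef_D ltnNge i2 /= ifT; last lia.
suff : path_coef N k n.-1 (n.+1 - (j - (n - 2)).+1) = 1 by rewrite -/N => ->.
by rewrite -jE -path_coef_sym; [congr path_coef; lia|lia|lia].
Qed.

(** The last index is 2(n-2), which is 0 modulo 4 for n even and 2 for n odd; so the tips are
    exchanged exactly for n odd. *)
Lemma coef_D_last (i m : 'I_n) : coef_D i.+1 (2 * n - 3).-1 m.+1 =
  ((if odd n then swap12 i else i) == m).
Proof.
have ni := ltn_ord i; have nm := ltn_ord m; rewrite -(inj_eq (@ord_inj n)).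
have -> : nat_of_ord (if odd n then swap12 i else i) = if odd n then
    (if i == 0 :> nat then 1 else if i == 1 :> nat then 0 else i : nat) else i.
  by case: ifP => // _; rewrite val_swap12 //; lia.
rewrite /coef_D.
move: (nat_of_ord i) (nat_of_ord m) ni nm => {}i {}m ni nm.
have [i2|i2] := ltnP 2 i.+1.
  have -> : (i == 0) = false by lia.
  have -> : (i == 1) = false by lia.
  rewrite if_same; have [m2|m2] := ltnP 2 m.+1.
    rewrite !path_coef_last; [|lia|lia].
    by do 3! case: eqP => // ?; exfalso; lia.
  rewrite path_coef_last; last lia.
  by do 2! case: eqP => // ?; exfalso; lia.
have [m2|m2] := ltnP 2 m.+1.
  rewrite path_coef_last; last lia.
  case: eqP => [?|_]; first by exfalso; lia.
  by case: i ni i2 => [|[|i]] // _ _; case: m nm m2 => [|[|m]] //; case: (odd n).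
have -> : (2 * n - 3).-1 < 2 * n - 3 by lia.
have -> : (2 * n - 3).-1 %% 4 = 2 * odd n.
  have -> : (2 * n - 3).-1 = (n./2 - 1) * 4 + 2 * odd n.
    by have := odd_double_half n; case: (odd n); lia.
  by rewrite modnMDl; case: (odd n).
by case: i ni i2 => [|[|i]] // _ _; case: m nm m2 => [|[|m]] // _ _; case: (odd n).
Qed.

Lemma chain_D (i i' : 'I_n) : i' = (if odd n then swap12 i else i) ->
  syzygy_chain (diagram_D n) (2 * n - 3) i i' (fun k m => coef_D i.+1 k m.+1).
Proof.
move=> ->; split=> [|m|m|k m kn|k kn|m|m].
- lia.
- by rewrite coef_D0 ?ltn_ord.
- exact: coef_D1.
- have [i2|i2] := ltnP 2 i.+1; first by rewrite coef_DS_chain // i2 ltn_ord.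
  by rewrite coef_DS_fork.
- exact: coef_D_neq0.
- exact: coef_D_last.
- by rewrite /coef_D; do 2! case: ifP => _; rewrite ?path_coef_end ?ltnn.
Qed.

End ChainsD.

Lemma sumn_iota n (F : nat -> nat) :
  sumn [seq F p | p <- iota 0 n] = \sum_(p < n) F p.
Proof. by rewrite sumnE big_map -(big_mkord xpredT F) /index_iota subn0. Qed.

(** * The exceptional diagrams, by computation *)

Section ComputedChains.

Variables (a : nat -> nat -> nat) (n : nat).

(** The subtraction is truncated, which is harmless because [check_chain] verifies the recursion in
    additive form. *)
Fixpoint chain_rows (h : nat) (u v : seq nat) : seq (seq nat) :=
  if h is h'.+1 then
    u :: chain_rows h' v
      [seq sumn [seq nth 0 v p * a p m | p <- iota 0 n] - nth 0 u m | m <- iota 0 n]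
  else [::].

Definition chain_table (h i : nat) : seq (seq nat) :=
  chain_rows h.+1 [seq nat_of_bool (i == p) | p <- iota 0 n]
    [seq a i p | p <- iota 0 n].

Definition computed_chain (h i k m : nat) : nat :=
  nth 0 (nth [::] (chain_table h i) k) m.

Definition check_chain (h i i' : nat) : bool :=
  let T := chain_table h i in let W k m := nth 0 (nth [::] T k) m in
  [&& 0 < h,
      all (fun m => W 0 m == (i == m)) (iota 0 n),
      all (fun m => W 1 m == a i m) (iota 0 n),
      all (fun k => all (fun m => W k.+2 m + W k m ==
        sumn [seq W k.+1 p * a p m | p <- iota 0 n]) (iota 0 n)) (iota 0 h.-1),
      all (fun k => has (fun m => W k m != 0) (iota 0 n)) (iota 0 h),
      all (fun m => W h.-1 m == (i' == m)) (iota 0 n)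
    & all (fun m => W h m == 0) (iota 0 n)].

Lemma check_chainP (A : 'M[nat]_n) h (i i' : 'I_n) :
  (forall p m : 'I_n, A p m = a p m) -> check_chain h i i' ->
  syzygy_chain A h i i' (fun k m => computed_chain h i k m).
Proof.
move=> AE; have mem_n (m : 'I_n) : nat_of_ord m \in iota 0 n by rewrite mem_iota add0n ltn_ord.
case/and5P=> h0 /allP c0 /allP c1 /allP cS /and3P[/allP cne /allP cl /allP ce].
split=> // [m|m|k m kh|k kh|m|m].
- exact/eqP/c0/mem_n.
- by rewrite AE; apply/eqP/c1/mem_n.
- have kI : k \in iota 0 h.-1 by rewrite mem_iota; lia.
  have /allP/(_ _ (mem_n m))/eqP E := cS k kI; apply: etrans E _.
  by rewrite sumn_iota; apply: eq_bigr => p _; rewrite AE.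
- have kI : k \in iota 0 h by rewrite mem_iota.
  have /hasP[m] := cne k kI.
  by rewrite mem_iota add0n => mn /eqP Wm; exists (Ordinal mn); exact: Wm.
- exact/eqP/cl/mem_n.
- exact/eqP/ce/mem_n.
Qed.

End ComputedChains.

(** The entries of [diagram_E] as a function on naturals, on which [vm_compute] can run. *)
Definition adj_E (n p m : nat) : nat :=
  let e i j := (j < n) && (j == i.+1) || (i == 3) && (j == n) in
  e p.+1 m.+1 || e m.+1 p.+1.

Definition flip_E6 (i : 'I_6) : 'I_6 := insubd i (if i < 5 then 4 - i else i : nat).

Lemma val_flip_E6 (i : 'I_6) : flip_E6 i = (if i < 5 then 4 - i else i) :> nat.
Proof. by rewrite val_insubd ifT //; have := ltn_ord i; case: ifP => _; lia. Qed.

Lemma chain_E6 i : syzygy_chain (diagram_E 6) 11 i (flip_E6 i)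
  (fun k m => computed_chain (adj_E 6) 6 11 i k m).
Proof.
apply: check_chainP => [p m|]; first by rewrite mxE.
have : all (fun i => check_chain (adj_E 6) 6 11 i (if i < 5 then 4 - i else i)) (iota 0 6).
  by vm_compute.
move/allP/(_ i); rewrite mem_iota ltn_ord => /(_ isT).
by rewrite val_flip_E6.
Qed.

Lemma chain_E78 n h (i : 'I_n) :
  all (fun i => check_chain (adj_E n) n h i i) (iota 0 n) ->
  syzygy_chain (diagram_E n) h i i (fun k m => computed_chain (adj_E n) n h i k m).
Proof.
move/allP/(_ i); rewrite mem_iota ltn_ord => /(_ isT) chk.
by apply: check_chainP => // p m; rewrite mxE.
Qed.

Lemma chain_E7 i : syzygy_chain (diagram_E 7) 17 i i
  (fun k m => computed_chain (adj_E 7) 7 17 i k m).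
Proof. by apply: chain_E78; vm_compute. Qed.

Lemma chain_E8 i : syzygy_chain (diagram_E 8) 29 i i
  (fun k m => computed_chain (adj_E 8) 8 29 i k m).
Proof. by apply: chain_E78; vm_compute. Qed.

End Combinatorics.

(** * Periods *)

Section Main.

Variables (K : closedFieldType) (L : falgType K) (J : {vspace L}).
Hypotheses (symL : symmetric_algebra L) (radJ : jacobson_radical J).
Hypothesis J3 : (J ^+ 3)%VS = 0%VS.
Variables (n : nat) (A : 'M[nat]_n).
Hypothesis nbrA : forall i, exists2 j, i != j & A i j != 0%N.

(** The form vanishes on the left ideal L x. *)
Lemma symmetric_form : exists nu : {scalar L},
  (forall a b, nu (a * b) = nu (b * a)) /\
  (forall x, (forall a, nu (a * x) = 0) -> x = 0).
Proof.
have [nu [nuC nuI]] := symL; exists nu; split=> // x nux.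
have I0 : limg (amulr x) = 0%VS.
  apply: nuI.
    left=> a _ /memv_imgP[b _ ->]; apply/memv_imgP; exists (a * b).
      exact: memvf.
    by rewrite !lfunE /= mulrA.
  by move=> _ /memv_imgP[b _ ->]; rewrite lfunE /= nux.
apply/eqP; rewrite -memv0 -I0; apply/memv_imgP; exists 1; first exact: memvf.
by rewrite lfunE /= mul1r.
Qed.

Lemma typed_syzygies : of_type L A -> exists S : 'I_n -> lmodType L,
  [/\ simples_enumeration S,
      forall i, exists P : projective_resolution (S i), minimal_resolution P
    & forall h i i' W, syzygy_chain A h i i' W ->
      syzygy h (S i) (S i') /\
      forall q T, (0 < q < h)%N -> simple_module T -> ~ syzygy q (S i) T].
Proof.
move=> [S [enumS extA]]; have [simS uniqS exhS] := enumS.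
have [nu [nuC nu_nondeg]] := symmetric_form.
have JL := radical_left radJ; have JR := radical_right radJ J3.
have J3' := radical3 J3.
have /choice[e eP] : forall i, exists e, primitive e /\
    exists s : S i, s <> 0 /\ e *: s = s.
  move=> i; have [e prim [s s0 es]] := simple_primitive (simS i).
  by exists e; split=> //; exists s.
have prim_e i : primitive (e i) by have [] := eP i.
have exs i : {s : S i | s <> 0 /\ e i *: s = s} by apply: cid; have [] := eP i.
pose s i : S i := sval (exs i).
have s0 i : s i <> 0 by have [] := svalP (exs i).
have es i : e i *: s i = s i by have [] := svalP (exs i).
have ee i := idem_e prim_e i.
have e_local i x := primitive_local radJ x (prim_e i).
have e_orth i j x := isotypic_radical radJ J3 enumS prim_e s0 es x (i := i) (j := j).
have e_gen := idempotents_generate enumS s0 es nu_nondeg.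
have e_notin i := primitive_notin_radical J3 (prim_e i).
have s_gen i := simple_generator (simS i) (s0 i).
have s_ann i := simple_annihilator radJ J3 (simS i) (prim_e i) (s0 i) (es i).
have s_eigen i := simple_eigen radJ J3 enumS prim_e s0 es (i := i).
have s_orth i j := simple_orth radJ J3 enumS prim_e s0 es (i := i) (j := j).
have s_rad (T : lmodType L) (a : L) (x : T) : simple_module T -> a \in J -> a *: x = 0.
  by move=> simT; apply: simple_radical.
exists S; split=> // [i|h i i' W chW].
  by eexists; apply: (simple_resolution_minimal JL JR J3' ee e_local e_orth e_gen
    (s_gen i) (s_ann i)).
split.
  exact: (chain_syzygy JL JR J3' ee e_local e_orth e_gen e_notin nuC nu_nondeg
    s0 s_gen s_ann s_eigen s_orth s_rad simS extA nbrA chW).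
move=> q T q0 simT.
exact: (chain_not_simple JL JR J3' ee e_local e_orth e_gen e_notin nuC nu_nondeg
    s0 s_gen s_ann s_eigen s_orth s_rad simS extA nbrA chW).
Qed.

Lemma simples_have_periodP (S : 'I_n -> lmodType L) (q : nat) :
  simples_enumeration S ->
  (forall i, exists P : projective_resolution (S i), minimal_resolution P) ->
  simples_have_period L q <-> forall i, syzygy q (S i) (S i).
Proof.
move=> [simS _ exhS] exP; split=> [per i|syz T P simT minP].
  have [P minP] := exP i; apply: (periodic_syzygy minP).
  exact: per.
have [i [f bf]] := exhS T simT.
exact: (syzygy_periodic (retarget_minimal bf minP) (syz i)).
Qed.

Lemma period_untwisted (h : nat) : (0 < n)%N -> of_type L A ->
  (forall i, exists W, syzygy_chain A h i i W) -> period_of_simples L h.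
Proof.
move=> n0 typeA chA; have [S [enumS exP syzP]] := typed_syzygies typeA.
pose i0 : 'I_n := Ordinal n0; have [W0 ch0] := chA i0.
split; first exact: (chain_gt0 ch0).
  apply/(simples_have_periodP _ enumS exP) => i; have [W chW] := chA i.
  by have [] := syzP _ _ _ _ chW.
move=> q qh /(simples_have_periodP _ enumS exP)/(_ i0).
have [simS _ _] := enumS; have [_ notS] := syzP _ _ _ _ ch0.
exact: notS.
Qed.

(** For i0 moved by tau, a smaller period q fails in each range: below h no syzygy is simple; q = h
    would identify S_{i0} with S_{tau i0}; above h, the (q-h)-th syzygy of S_{tau i0} would be
    simple. *)
Lemma period_twisted (h : nat) (tau : 'I_n -> 'I_n) : of_type L A ->
  (forall i, exists W, syzygy_chain A h i (tau i) W) ->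
  involutive tau -> (exists i, tau i != i) -> period_of_simples L (2 * h).
Proof.
move=> typeA chA tauK [i0 ti0].
have [S [enumS exP syzP]] := typed_syzygies typeA; have [simS uniqS _] := enumS.
have [W0 ch0] := chA i0; have h0 := chain_gt0 ch0.
have syzh i : syzygy h (S i) (S (tau i)).
  by have [W chW] := chA i; have [] := syzP _ _ _ _ chW.
have notS i q T : (0 < q < h)%N -> simple_module T -> ~ syzygy q (S i) T.
  by have [W chW] := chA i; have [_] := syzP _ _ _ _ chW; apply.
split; first by rewrite muln_gt0.
  apply/(simples_have_periodP _ enumS exP) => i; rewrite mul2n -addnn.
  by apply: syzygy_add (syzh i) _; rewrite -{2}(tauK i).
move=> q /andP[q0 qh] /(simples_have_periodP _ enumS exP)/(_ i0) syzq.
have [P minP] := exP i0; have [qlt|qgt|qE] := ltngtP q h.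
- by apply: (notS i0 q (S i0)) syzq; rewrite ?q0.
- apply: (notS (tau i0) (q - h)%N (S i0)) => //; first by lia.
  by apply: (syzygy_sub minP (syzh i0)); rewrite subnK // ltnW.
- case/eqP: ti0; apply: uniqS; apply: (syzygy_unique minP (syzh i0)).
  by rewrite -qE.
Qed.

End Main.

Section Neighbours.

Variable n : nat.

Lemma path_neighbour (A : 'M[nat]_n) : (1 < n)%N ->
  (forall i j : 'I_n, j = i.+1 :> nat -> A i j != 0%N /\ A j i != 0%N) ->
  forall i, exists2 j, i != j & A i j != 0%N.
Proof.
move=> n1 AP i; have [i1|i1] := ltnP i.+1 n.
  exists (Ordinal i1); first by rewrite -val_eqE /=; lia.
  by have [] := AP i (Ordinal i1) erefl.
have i1' : (i.-1 < n)%N by have := ltn_ord i; lia.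
exists (Ordinal i1'); first by rewrite -val_eqE /=; lia.
have [|_ //] := AP (Ordinal i1') i; rewrite /=; lia.
Qed.

Lemma neighbour_A : (1 < n)%N ->
  forall i, exists2 j, i != j & diagram_A n i j != 0%N.
Proof.
by move=> n1; apply: path_neighbour => // i j ij; rewrite !mxE ij eqxx ?orbT.
Qed.

Lemma neighbour_L : (1 < n)%N ->
  forall i, exists2 j, i != j & diagram_L n i j != 0%N.
Proof.
by move=> n1; apply: path_neighbour => // i j ij; rewrite !mxE ij eqxx /= ?orbT.
Qed.

Lemma neighbour_D : (3 < n)%N ->
  forall i, exists2 j, i != j & diagram_D n i j != 0%N.
Proof.
move=> n4 i; have ni := ltn_ord i.
have j1 : ((if i < 2 then 2 else if i == 2 :> nat then 0 else i.-1) < n)%N.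
  by do 2? case: ifP => // _; lia.
exists (Ordinal j1); first by rewrite -val_eqE /=; do 2? case: ifP => ?; lia.
rewrite mxE /=; do 2? case: ifP => ?; lia.
Qed.

Lemma neighbour_E : (4 < n)%N ->
  forall i, exists2 j, i != j & diagram_E n i j != 0%N.
Proof.
move=> n4 i; have ni := ltn_ord i.
have j1 : ((if i == n.-1 :> nat then 2 else if i == 0 :> nat then 1 else i.-1) < n)%N.
  by do 2? case: ifP => // _; lia.
exists (Ordinal j1); first by rewrite -val_eqE /=; do 2? case: ifP => ?; lia.
rewrite mxE /=; do 2? case: ifP => ?; lia.
Qed.

End Neighbours.

Theorem theorem4p2 (K : closedFieldType) (L : falgType K) (J : {vspace L})
  (indecL : indecomposable_algebra L) (symL : symmetric_algebra L)
  (radJ : jacobson_radical J)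
  (J3 : (J ^+ 3)%VS = 0%VS) (J2 : (J ^+ 2)%VS <> 0%VS) :
  (forall n : nat, (2 <= n)%N ->
     of_type L (diagram_A n) -> period_of_simples L (2 * n)%N) /\
  (forall n : nat, (2 <= n)%N ->
     of_type L (diagram_L n) -> period_of_simples L (2 * n)%N) /\
  (forall n : nat, (4 <= n)%N ->
     of_type L (diagram_D n) ->
       (~~ odd n -> period_of_simples L (2 * n - 3)%N) /\
       (odd n -> period_of_simples L (2 * (2 * n - 3))%N)) /\
  ((of_type L (diagram_E 6) -> period_of_simples L 22) /\
   (of_type L (diagram_E 7) -> period_of_simples L 17) /\
   (of_type L (diagram_E 8) -> period_of_simples L 29)).
Proof.
split=> [n n2 typeA|]; last split=> [n n2 typeA|]; last split=> [n n2 typeA|];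
  last split; last split.
- apply: (period_twisted symL radJ J3 (neighbour_A n2) typeA (tau := @rev_ord n)).
  + by move=> i; eexists; apply: chain_A.
  + exact: rev_ordK.
  + by exists (Ordinal (ltnW n2)); rewrite -val_eqE /=; lia.
- apply: (period_untwisted symL radJ J3 (neighbour_L n2) _ typeA); first exact: ltnW.
  by move=> i; eexists; apply: chain_L.
- split=> oddn.
    apply: (period_untwisted symL radJ J3 (neighbour_D n2) _ typeA); first by lia.
    by move=> i; eexists; apply: chain_D; rewrite // (negPf oddn).
  apply: (period_twisted symL radJ J3 (neighbour_D n2) typeA (tau := @swap12 n)).
  + by move=> i; eexists; apply: chain_D; rewrite ?oddn.
  + move=> i; apply: val_inj; rewrite /= !val_swap12; [|lia|lia].
    by case: (nat_of_ord i) => [|[|m]].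
  + have n0 : (0 < n)%N by lia.
    by exists (Ordinal n0); rewrite -val_eqE /= val_swap12 //; lia.
- move=> typeE.
  (* The Coxeter numbers of E_6, E_7, E_8 are 12, 18, 30; only E_6 is twisted, hence 22 = 2 * 11,
     while 17 and 29 are not doubled. *)
  apply: (@period_twisted _ _ _ symL radJ J3 _ _ (neighbour_E _) 11 flip_E6 typeE) => //.
  + by move=> i; eexists; apply: chain_E6.
  + move=> i; apply: val_inj; rewrite /= !val_flip_E6.
    by case: i => [[|[|[|[|[|[|]]]]]]].
  + by exists ord0; rewrite -val_eqE /= val_flip_E6.
- move=> typeE.
  apply: (period_untwisted symL radJ J3 (neighbour_E _) _ typeE) => //.
  by move=> i; eexists; apply: chain_E7.
- move=> typeE.
  apply: (period_untwisted symL radJ J3 (neighbour_E _) _ typeE) => //.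
  by move=> i; eexists; apply: chain_E8.
Qed.
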